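(* There is no finite planar map with straight edges of equal length that is regular of degree $5$. That is, there do not exist a finite nonempty set $V$ of points in the Euclidean plane $\mathbb{R}^2$ and a set $E$ of closed straight line segments, each joining two distinct points of $V$, such that: (i) all segments in $E$ have the same length; (ii) any two distinct segments in $E$ intersect in at most one point, and that point, if it exists, is a common endpoint of both; (iii) no point of $V$ lies in the relative interior of a segment of $E$; and (iv) every point of $V$ is an endpoint of exactly $5$ segments of $E$.
   Context: A planar map with straight edges is a finite graph drawn in the plane with vertices as distinct points and edges as straight line segments between their endpoints, such that edges do not cross or overlap (two edges meet at most in a common endpoint, and no vertex lies in the interior of an edge). Such a configuration with all edges of equal length is sometimes called a match-stick graph. Regular of degree $5$ means each vertex is on exactly $5$ edges. *)

(* Defs.v *)
From HB Require Import structures.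
From mathcomp Require Import all_boot all_order all_algebra.
From mathcomp Require Import all_classical all_reals.

Set Implicit Arguments.
Unset Strict Implicit.
Unset Printing Implicit Defensive.

Import Order.TTheory GRing.Theory Num.Theory.

Local Open Scope classical_set_scope.
Local Open Scope ring_scope.

Section Plane.
Variable R : realType.

Definition plane : Type := (R * R)%type.

Implicit Types (a b p : plane) (s : set plane).

(* Not the library norm on R * R, which is the sup norm. *)
Definition edist a b : R :=
  Num.sqrt ((a.1 - b.1) ^+ 2 + (a.2 - b.2) ^+ 2).

Definition seg_point a b (t : R) : plane :=
  ((1 - t) * a.1 + t * b.1, (1 - t) * a.2 + t * b.2).

Definition segment a b : set plane :=
  [set seg_point a b t | t in [set t : R | 0 <= t <= 1]].

Definition open_segment a b : set plane :=
  [set seg_point a b t | t in [set t : R | 0 < t < 1]].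

(* A segment is a set of points; as a nondegenerate segment determines its
   endpoints up to order, [joins s a b] holds for exactly two ordered pairs
   (a, b) when s is such a segment. *)
Definition joins s a b : Prop := a <> b /\ s = segment a b.

Definition endpoint p s : Prop := exists q, joins s p q.

Definition in_relint p s : Prop :=
  exists a b, joins s a b /\ open_segment a b p.


Definition straight_planar_map (V : set plane) (E : set (set plane)) : Prop :=
  [/\ finite_set V,
      forall s, E s -> exists a b, [/\ V a, V b & joins s a b],
      forall s t, E s -> E t -> s <> t ->
        is_subset1 (s `&` t) /\
        (forall x, (s `&` t) x -> endpoint x s /\ endpoint x t)
    & forall p s, V p -> E s -> ~ in_relint p s].

Definition equal_edges (E : set (set plane)) : Prop :=
  exists l : R, forall s a b, E s -> joins s a b -> edist a b = l.

Definition regular_of_degree (d : nat) (V : set plane)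
    (E : set (set plane)) : Prop :=
  forall p, V p -> ([set s | E s /\ endpoint p s] #= `I_d)%card.

End Plane.

(* Main.v *)
Require Import Defs.
From mathcomp Require Import all_boot all_order all_algebra.
From mathcomp Require Import all_classical all_reals.
From mathcomp Require Import trigo.
From mathcomp Require Import zify ring lra.

(** Discharging with angles.  Give a corner of angle [alpha] the excess
    [3 alpha / pi - 1]; the five excesses at a vertex add up to 1.  Truncate the
    excess of every corner to [[0, 1]], calling the result the gift of the
    corner: the gifts at a vertex add up to at least 1.  On the other hand, in a
    face with k corners and angle sum at least (k - 2) pi the gifts add up to at
    most the excesses: this is clear when no angle is below [pi / 3] and when
    k >= 6, it costs one corner when k = 5, and for k = 4 (a rhombus) small
    angles come in opposite pairs, while a triangle has no small angle.  On the
    unbounded face the inequality is strict, a contradiction.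

    That a face with k corners has angle sum at least (k - 2) pi, and at least
    (k + 2) pi if unbounded, is proved by sweeping a vertical line over the
    drawing.  The edge sides are labelled along the way: a gap of the sweep line
    opening at a vertex gets a fresh label, two gaps that merge at a vertex get
    their labels identified.  The turning number of a label class is the number
    of openings minus the number of merges, hence at most 1.  Label classes are
    unions of face boundaries and replace faces throughout, so neither the Jordan
    curve theorem nor Euler's formula is needed. *)

Set Implicit Arguments.
Unset Strict Implicit.
Unset Printing Implicit Defensive.

Import Order.TTheory GRing.Theory Num.Theory.

(** * Labelling the gaps of a sweep *)

Section SweepLabelling.
Variable T : eqType.
Implicit Types (lo up : T -> nat) (s : seq T).

(* The labels met when crossing the edges s upwards, from c to c': the side of e
   below it carries lo e, the one above it up e. *)
Fixpoint chain lo up (c : nat) s (c' : nat) : bool :=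
  if s is e :: s' then (lo e == c) && chain lo up (up e) s' c' else c == c'.

Lemma chain_cat lo up c s1 s2 c' :
  reflect (exists2 m, chain lo up c s1 m & chain lo up m s2 c')
          (chain lo up c (s1 ++ s2) c').
Proof.
elim: s1 c => [|e s1 IH] c /=.
  by apply: (iffP idP) => [h|[m /eqP->]//]; exists c.
by apply: (iffP andP) => [[-> /IH[m h1 h2]]|[m /andP[-> h1] h2]];
  [exists m | split=> //; apply/IH; exists m].
Qed.

Lemma eq_chain lo up lo' up' c s c' :
  {in s, lo =1 lo'} -> {in s, up =1 up'} ->
  chain lo up c s c' = chain lo' up' c s c'.
Proof.
elim: s c => [|e s IH] c //= hlo hup.
rewrite hlo ?mem_head // hup ?mem_head // IH // => z zs;
  by [apply: hlo; rewrite inE zs orbT | apply: hup; rewrite inE zs orbT].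
Qed.

Lemma chain_relabel rho lo up c s c' : chain lo up c s c' ->
  chain (rho \o lo) (rho \o up) (rho c) s (rho c').
Proof. by elim: s c => [|e s IH] c /= => [/eqP->|/andP[/eqP-> /IH->]]; rewrite eqxx. Qed.

(** Bottom up, the gaps between consecutive edges starting at a vertex get the fresh labels [N],
    [N + 1], ..., and the gap above the topmost edge keeps [t]; so each fresh label is opened at
    most once. *)
Lemma chain_extend lo up s (b t N : nat) : uniq s -> s != [::] ->
  exists lo' up', [/\ {in [predC s], lo =1 lo'}, {in [predC s], up =1 up'},
    chain lo' up' b s t
  & forall c, (count_mem c (map up' s) <= (t == c) + (N <= c < N + size s))%N].
Proof.
elim: s b N => [|e s IH] b N //= /andP[es us] _.
have [s0|sN0] := eqVneq s [::].
  exists [eta lo with e |-> b], [eta up with e |-> t]; rewrite s0 /= !eqxx.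
  by split=> // [z|z|c]; rewrite ?inE ?addn0 ?leq_addr //; case: eqP.
have [lo' [up' [hlo hup hc hn]]] := IH N N.+1 us sN0.
exists [eta lo' with e |-> b], [eta up' with e |-> N].
have es' z : z \in s -> z != e by apply: contraTneq => ->.
split=> [z|z||c] /=.
- by rewrite !inE negb_or => /andP[/negPf-> zs]; apply: hlo.
- by rewrite !inE negb_or => /andP[/negPf-> zs]; apply: hup.
- rewrite !eqxx /=; rewrite -(eq_chain (lo := lo') (up := up')) // => z zs /=;
    by rewrite (negPf (es' _ zs)).
- rewrite eqxx (_ : map _ s = map up' s); last first.
    by apply/eq_in_map => z zs /=; rewrite (negPf (es' _ zs)).
  move: (hn c) => /=; case: (t == c); case: (N == c) / eqP; lia.
Qed.

(* Openings minus merges of label c at the first k vertices: every starting edge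
   except the topmost one has an opening gap above it, and t j labels the gap
   above vertex j, which is a merged gap if no edge starts at j. *)
Definition charge up (Rr : nat -> seq T) (t : nat -> nat) (k c : nat) : int :=
  (\sum_(0 <= j < k) ((count_mem c (map up (Rr j)))%:Z - (t j == c)%:Z))%R.

(** [S k] lists bottom up the edges met just before vertex [k]. There the edges [L k], between [A k]
    and [B k], end and are replaced by [Rr k]; [birth] is the vertex at which an edge starts. *)
Variables (n : nat) (A L Rr B S : nat -> seq T) (birth : T -> nat).
Hypothesis Sl : forall k, k <= n -> S k = A k ++ L k ++ B k.
Hypothesis Sr : forall k, k < n -> S k.+1 = A k ++ Rr k ++ B k.
Hypothesis S0 : S 0 = [::].
Hypothesis Sn : A n ++ Rr n ++ B n = [::].
Hypothesis birthR : forall k e, k <= n -> e \in Rr k -> birth e = k.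
Hypothesis birthS : forall k e, k <= n -> e \in S k -> birth e < k.
Hypothesis uniqR : forall k, uniq (Rr k).

Local Notation corners lo up b t k :=
  (chain lo up (b k) (L k) (t k) && chain lo up (b k) (Rr k) (t k)).

(** Charge is additive over identified labels, which is what a merge of two gaps needs. *)
Lemma charge_relabel up (t : nat -> nat) (a b k c : nat) : a != b ->
  let rho := fun z : nat => if z == a then b else z in
  charge (rho \o up) Rr (rho \o t) k c =
  (if c == a then 0 else charge up Rr t k c +
    (if c == b then charge up Rr t k a else 0))%R.
Proof.
move=> ab rho.
have rhoE z : ((rho z == c) : nat) =
    if c == a then 0 else (z == c) + (if c == b then (z == a) : nat else 0).
  by move/eqP: ab => ab; rewrite /rho; case: (z =P a) => ?; case: (c =P a) => ?;
    case: (c =P b) => ?; lia.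
rewrite /charge; case: ifP => ca.
  apply: big1 => j _; rewrite /= rhoE ca (_ : count_mem _ _ = 0) //.
  by rewrite -size_filter; apply/eqP; rewrite size_eq0 -(negbK (_ == _)) -has_filter;
    apply/negP => /hasP[z /mapP[y _ ->]] /=; move: (rhoE (up y)); rewrite ca;
      case: (_ == _).
have cnt j : count_mem c [seq (rho \o up) i | i <- Rr j] =
   count_mem c [seq up i | i <- Rr j] + (if c == b then count_mem a [seq up i | i <- Rr j] else 0).
  elim: (Rr j) => [|z s IH] /=; first by case: ifP.
  by rewrite IH rhoE ca; case: (c == b); rewrite ?addn0 // addnACA.
case: ifP => cb; last first.
  by rewrite addr0; apply: eq_bigr => j _; rewrite cnt /= rhoE ca cb !addn0.
by rewrite -big_split /=; apply: eq_bigr => j _;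
  rewrite cnt /= rhoE ca cb !PoszD opprD addrACA.
Qed.

(** Label 0 belongs to the unbounded ends of the sweep line; labels from [N] on are fresh. An
    opening gives a fresh label charge at most 1. A merge costs 1, so the bound becomes 1 + 1 - 1 =
    1, or 1 + 0 - 1 = 0 when label 0 is involved. *)
Lemma sweep_invariant k : k <= n -> exists lo up b t N,
  [/\ chain lo up 0 (S k) 0, forall j, j < k -> corners lo up b t j, 0 < N
   & forall c, (charge up Rr t k c <= (0 < c < N)%:Z)%R].
Proof.
elim: k => [|k IH] kn.
  exists (fun=> 0), (fun=> 0), (fun=> 0), (fun=> 0), 1; split => // [|c].
    by rewrite S0.
  by rewrite /charge big_geq.
have [lo [up [b [t [N [hS hc N0 hN]]]]]] := IH (ltnW kn).
move: (hS); rewrite Sl 1?ltnW // => /chain_cat[be hA /chain_cat[ta hL hB]].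
have setb (f : nat -> nat) v j : j < k -> [eta f with k |-> v] j = f j.
  by move=> jk /=; rewrite ltn_eqF.
have chargeS up' t' c : charge up' Rr t' k.+1 c = (charge up' Rr t' k c +
    ((count_mem c (map up' (Rr k)))%:Z - (t' k == c)%:Z))%R.
  by rewrite /charge big_nat_recr.
have charget up' v c : charge up' Rr [eta t with k |-> v] k c = charge up' Rr t k c.
  by apply: eq_big_nat => j /andP[_ jk]; rewrite setb.
have [R0|RN0] := eqVneq (Rr k) [::]; last first.
  have [lo' [up' [hlo hup hR hcnt]]] := chain_extend lo up be ta N (uniqR k) RN0.
  (* Edges born earlier are not in [Rr k], so the corners checked so far survive the relabelling. *)
  have old e : birth e < k -> e \in [predC Rr k].
    by move=> ek; apply/negP => /(birthR (ltnW kn)) eq; rewrite eq ltnn in ek.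
  have oldc (s : seq T) c c' : {in s, forall e, birth e < k} ->
      chain lo up c s c' = chain lo' up' c s c'.
    by move=> h; apply: eq_chain => e /h /old; [apply: hlo | apply: hup].
  have bS e : e \in S k -> birth e < k by apply: birthS; exact: ltnW.
  move: bS; rewrite Sl 1?ltnW // => bS.
  have hA' : chain lo' up' 0 (A k) be.
    by rewrite -oldc // => e eA; apply: bS; rewrite mem_cat eA.
  have hL' : chain lo' up' be (L k) ta.
    by rewrite -oldc // => e eA; apply: bS; rewrite !mem_cat eA orbT.
  have hB' : chain lo' up' ta (B k) 0.
    by rewrite -oldc // => e eA; apply: bS; rewrite !mem_cat eA !orbT.
  exists lo', up', [eta b with k |-> be], [eta t with k |-> ta], (N + size (Rr k)).
  split.
  - by rewrite Sr //; apply/chain_cat; exists be => //; apply/chain_cat; exists ta.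
  - move=> j; rewrite ltnS leq_eqVlt => /orP[/eqP->|jk].
      by rewrite /= eqxx hL' hR.
    rewrite !setb //; have := hc j jk; rewrite (oldc (L j)) ?(oldc (Rr j)) //.
      by move=> e /birthR-> //; lia.
    move=> e eL; apply: (@leq_trans j); last exact: ltnW.
    by apply: birthS; [lia | rewrite Sl ?mem_cat ?eL ?orbT //; lia].
  - lia.
  - move=> c; rewrite chargeS charget /= eqxx.
    have -> : charge up' Rr t k c = charge up Rr t k c.
      apply: eq_big_nat => j /andP[_ jk].
      rewrite (_ : map up' (Rr j) = map up (Rr j)) //.
      by apply/eq_in_map => e /birthR be'; rewrite hup // old // be' //; lia.
    move: (hN c) (hcnt c); move: (charge _ _ _ _ _) (count _ _) (size _) => X Y Z.
    by case: (ta == c); lia.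
have [bt|bt] := eqVneq be ta.
  exists lo, up, [eta b with k |-> be], [eta t with k |-> ta], N; split => //.
  - by rewrite Sr // R0 /=; apply/chain_cat; exists be => //; rewrite bt.
  - move=> j; rewrite ltnS leq_eqVlt => /orP[/eqP->|jk].
      by rewrite /= eqxx hL R0 /= bt.
    by rewrite !setb //; apply: hc.
  - by move=> c; rewrite chargeS charget /= R0 /=; move: (hN c); lia.
(* The label [a] that disappears must not be 0, so that 0 remains the label at both ends of the
   sweep line. *)
have [a [a' [aa' a0 rhoE]]] : exists a a', [/\ a != a', a != 0 &
    let rho := fun z : nat => if z == a then a' else z in rho be = a' /\ rho ta = a'].
  have [ta0|ta0] := eqVneq ta 0.
    by exists be, ta; rewrite -ta0 /= eqxx [ta == be]eq_sym (negPf bt).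
  by exists ta, be; rewrite eq_sym /= eqxx (negPf bt).
set rho := fun z : nat => if z == a then a' else z in rhoE.
have [rb rt] := rhoE.
have r0 : rho 0 = 0 by rewrite /rho eq_sym (negPf a0).
exists (rho \o lo), (rho \o up), [eta (rho \o b) with k |-> a'],
  [eta (rho \o t) with k |-> a'], N; split=> //.
- rewrite Sr // R0 /=; apply/chain_cat; exists a'.
    by rewrite -{1}r0 -rb; apply: chain_relabel.
  by rewrite -[X in chain _ _ _ _ X]r0 -rt; apply: chain_relabel.
- move=> j; rewrite ltnS leq_eqVlt => /orP[/eqP->|jk].
    by rewrite /= eqxx R0 /= eqxx andbT -{1}rb -rt; apply: chain_relabel.
  by rewrite !setb //; have /andP[h1 h2] := hc j jk; apply/andP; split;
    apply: chain_relabel.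
- move=> c; rewrite chargeS R0 /= eqxx.
  have -> : charge (rho \o up) Rr [eta (rho \o t) with k |-> a'] k c =
            charge (rho \o up) Rr (rho \o t) k c.
    by apply: eq_big_nat => j /andP[_ jk]; rewrite setb.
  rewrite charge_relabel //; case: eqP => ca; first by lia.
  rewrite [a' == c]eq_sym; case: (eqVneq c a') => [->|ca'] /=.
    by move: (hN a) (hN a'); lia.
  by move: (hN c); lia.
Qed.

(** At vertex [n] all remaining edges end, and the gaps below and above both carry 0. This last
    merge subtracts 1 from the charge of label 0, which was at most 0. *)
Lemma sweep_labelling : exists lo up b t,
  (forall k, k <= n -> corners lo up b t k) /\
  (forall c, (charge up Rr t n.+1 c <= if c == 0%N then -1 else 1)%R).
Proof.
have [lo [up [b [t [N [hS hc N0 hN]]]]]] := sweep_invariant (leqnn n).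
move: hS Sn; rewrite Sl //; case: (A n) => //; case Rn : (Rr n) => //.
case: (B n) => //; rewrite cats0 /= => hL _.
exists lo, up, [eta b with n |-> 0], [eta t with n |-> 0]; split=> [k|c].
  rewrite leq_eqVlt => /orP[/eqP->|kn]; first by rewrite /= eqxx hL Rn.
  by rewrite /= ltn_eqF //; apply: hc.
rewrite /charge big_nat_recr //= eqxx Rn /=.
under eq_big_nat => j /andP[_ jn] do rewrite (ltn_eqF jn).
move: (hN c); rewrite /charge; move: (\sum_(0 <= j < n) _)%R => X;
  rewrite [0%N == c]eq_sym; case: (c =P 0%N) => [->|] /=; lia.
Qed.

End SweepLabelling.

(** * Sweeping a straight-line drawing *)

Section KeySort.
Variables (R : realType) (T : eqType) (f : T -> R).

Definition ksort : seq T -> seq T := sort (fun a b => f a <= f b)%R.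

Lemma ltkey_trans : transitive (fun a b => f a < f b)%R.
Proof. by move=> b a c; apply: lt_trans. Qed.

Lemma ksort_lt s : uniq (map f s) -> sorted (fun a b => f a < f b)%R (ksort s).
Proof.
move=> us;
  have <- : sorted <%R (map f (ksort s)) = sorted (fun a b => f a < f b)%R (ksort s).
  exact: sorted_map.
rewrite lt_sorted_uniq_le.
rewrite (perm_uniq (perm_map f (_ : perm_eq _ s))) ?us ?perm_sort //=.
by rewrite sorted_map sort_sorted // => a b; apply: le_total.
Qed.

Lemma ksort_eq s t : uniq s -> s =i t -> sorted (fun a b => f a < f b)%R t ->
  ksort s = t.
Proof.
move=> us st tS.
have ut : uniq (map f t) by apply: lt_sorted_uniq; rewrite sorted_map.
have pst : perm_eq s t by apply: uniq_perm => //; exact: map_uniq ut.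
have sS : sorted (fun a b => f a < f b)%R (ksort s).
  by apply: ksort_lt; rewrite (perm_uniq (perm_map f pst)).
apply: (irr_sorted_eq ltkey_trans _ sS tS) => a; first exact: ltxx.
by rewrite mem_sort st.
Qed.

End KeySort.

(** * Straight-line drawings and the states of the sweep line *)

Section Drawing.
Variables (R : realType) (n : nat) (x y : nat -> R) (e : rel nat).
Local Open Scope ring_scope.

Definition edge_slope i j : R := (y j - y i) / (x j - x i).
Definition height (p : nat * nat) z : R := y p.1 + edge_slope p.1 p.2 * (z - x p.1).

Definition right_edge (p : nat * nat) : bool := e p.1 p.2 && (p.1 < p.2)%N.
Definition strictly_over (p : nat * nat) z : bool := x p.1 < z < x p.2.
Definition weakly_over (p : nat * nat) z : bool := x p.1 <= z <= x p.2.

(* Vertices are 0, ..., n, numbered by increasing abscissa. *)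
Record drawing : Prop := Drawing {
  e_sym : symmetric e;
  e_irr : irreflexive e;
  e_le : forall i j, e i j -> (i <= n)%N;
  x_mono : forall i j, (i < j <= n)%N -> x i < x j;
  noncrossing : forall p q z, right_edge p -> right_edge q -> p != q ->
    strictly_over p z -> strictly_over q z -> height p z != height q z;
  off_vertices : forall p k, right_edge p -> (p.1 < k < p.2)%N ->
    height p (x k) != y k }.

Hypothesis D : drawing.

Lemma right_edge_le p : right_edge p -> (p.1 < p.2 <= n)%N.
Proof. by case/andP => ep ->; rewrite (e_le D (j := p.1)) // e_sym. Qed.

Lemma x_le i j : (i <= j <= n)%N -> x i <= x j.
Proof.
move=> /andP[]; rewrite leq_eqVlt => /orP[/eqP-> //|ij jn].
by apply/ltW/(x_mono D); rewrite ij.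
Qed.

Lemma x_neq p : right_edge p -> x p.2 - x p.1 != 0.
Proof. by move/right_edge_le/(x_mono D); rewrite -subr_gt0 => /gt_eqF->. Qed.

Lemma height1 p : height p (x p.1) = y p.1.
Proof. by rewrite /height subrr mulr0 addr0. Qed.

Lemma height2 p : right_edge p -> height p (x p.2) = y p.2.
Proof. by move=> /x_neq h; rewrite /height /edge_slope mulfVK // addrC subrK. Qed.

Lemma slopeC i j : edge_slope i j = edge_slope j i.
Proof. by rewrite /edge_slope -[y j - _]opprB -[x j - _]opprB invrN mulrNN. Qed.

Lemma height_end p z : right_edge p ->
  height p z = y p.2 + edge_slope p.2 p.1 * (z - x p.2).
Proof. by move=> hp; rewrite -(height2 hp) /height [edge_slope p.2 _]slopeC; ring. Qed.

(** The difference of the heights is affine; a change of order would make it vanish at an abscissa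
    strictly over both edges, against [noncrossing]. *)
Lemma height_lt_transfer p q z w : right_edge p -> right_edge q -> p != q ->
  weakly_over p z -> weakly_over q z -> strictly_over p w -> strictly_over q w ->
  height p z < height q z -> height p w < height q w.
Proof.
move=> hp hq pq /andP[pz1 pz2] /andP[qz1 qz2] pw qw hz.
rewrite ltNge; apply/negP => hw.
move: (pw) (qw) => /andP[pw1 pw2] /andP[qw1 qw2].
pose a := height q z - height p z; pose b := height p w - height q w.
have a0 : 0 < a by rewrite subr_gt0.
have b0 : 0 <= b by rewrite subr_ge0.
have ab : 0 < a + b by rewrite ltr_pwDl.
(* The zero of the height difference. As [a > 0], the weight of [w] is positive, so [u] is strictly
   over both edges even if [z] is at an end of one. *)
pose u := (b / (a + b)) * z + (a / (a + b)) * w.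
have sum1 : b / (a + b) + a / (a + b) = 1.
  by rewrite -mulrDl [b + a]addrC divff // gt_eqF.
have ca : 0 < a / (a + b) by rewrite divr_gt0.
have cb : 0 <= b / (a + b) by rewrite divr_ge0 // ltW.
have over r : x r.1 <= z -> z <= x r.2 -> x r.1 < w -> w < x r.2 -> strictly_over r u.
  move=> h1 h2 h3 h4; rewrite /strictly_over /u; move: sum1 ca cb.
  by move: (b / _) (a / _) => B A ? ? ?; apply/andP; split; nra.
have /eqP := noncrossing D hp hq pq (over p pz1 pz2 pw1 pw2) (over q qz1 qz2 qw1 qw2).
apply.
have aff r : height r u = b / (a + b) * height r z + a / (a + b) * height r w.
  rewrite /u /height; move: sum1; move: (b / _) (a / _) => B A h.
  by rewrite -[y r.1 in LHS]mul1r -[x r.1 in LHS]mul1r -h; ring.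
apply/eqP; rewrite -subr_eq0 !aff.
rewrite [X in X == _](_ : _ = (b / (a + b)) * (- a) + a / (a + b) * b).
  by apply/eqP; field; exact: lt0r_neq0.
by rewrite /a /b; ring.
Qed.

Definition left_nbrs i := ksort (edge_slope i) [seq j <- iota 0 i | e i j].
Definition right_nbrs i := ksort (edge_slope i) [seq j <- iota i.+1 (n - i) | e i j].

Lemma mem_left_nbrs i j : (j \in left_nbrs i) = e i j && (j < i)%N.
Proof. by rewrite mem_sort mem_filter mem_iota. Qed.

Lemma mem_right_nbrs i j : (j \in right_nbrs i) = e i j && (i < j)%N.
Proof.
rewrite mem_sort mem_filter mem_iota; case eij : (e i j) => //=.
by rewrite addSn ltnS subnKC ?(e_le D eij) // (e_le D (j := i)) ?andbT // e_sym.
Qed.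

(** If the slopes agreed, the nearer neighbour would lie on the edge to the farther one, against
    [off_vertices]. *)
Lemma slope_inj i j k : e i j -> e i k -> (j < k)%N ->
  (i < j)%N || (k < i)%N -> edge_slope i j != edge_slope i k.
Proof.
move=> eij eik jk /orP[ij|ki]; apply/eqP => s.
  have h : right_edge (i, k) by rewrite /right_edge /= eik (ltn_trans ij).
  have h' : right_edge (i, j) by rewrite /right_edge /= eij.
  suff : height (i, k) (x j) = y j.
    by apply/eqP/(off_vertices D h); rewrite /= ij.
  by rewrite -(height2 h') /height /= s.
have h : right_edge (j, i) by rewrite /right_edge /= e_sym // eij (ltn_trans jk).
have h' : right_edge (k, i) by rewrite /right_edge /= e_sym // eik.
suff : height (j, i) (x k) = y k by apply/eqP/(off_vertices D h); rewrite /= jk.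
by rewrite -[y k](height1 (k, i)) !height_end //= s.
Qed.

Lemma map_slope_uniq i s : uniq s -> all (e i) s ->
  all (fun j => i < j)%N s || all (fun j => j < i)%N s -> uniq (map (edge_slope i) s).
Proof.
move=> us es sides; rewrite map_inj_in_uniq // => j k js ks jk.
have [ej ek] := (allP es _ js, allP es _ ks).
apply/eqP/negPn/negP; rewrite neq_ltn => /orP[] lt;
  [suff : edge_slope i j != edge_slope i k by rewrite jk eqxx
  |suff : edge_slope i k != edge_slope i j by rewrite jk eqxx]; apply: slope_inj => //;
  by case/orP: sides => /allP h; rewrite ?(h _ js) ?(h _ ks) ?orbT.
Qed.

Lemma left_nbrs_sorted i : sorted (fun j k => edge_slope i j < edge_slope i k) (left_nbrs i).
Proof.
apply/ksort_lt/map_slope_uniq; rewrite ?filter_uniq ?iota_uniq ?filter_all //.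
by apply/orP; right; apply/allP => j; rewrite mem_filter mem_iota => /and3P[].
Qed.

Lemma right_nbrs_sorted i : sorted (fun j k => edge_slope i j < edge_slope i k) (right_nbrs i).
Proof.
apply/ksort_lt/map_slope_uniq; rewrite ?filter_uniq ?iota_uniq ?filter_all //.
by apply/orP; left; apply/allP => j; rewrite mem_filter mem_iota => /and3P[].
Qed.

Lemma left_nbrs_uniq i : uniq (left_nbrs i).
Proof. by rewrite sort_uniq filter_uniq ?iota_uniq. Qed.

Lemma right_nbrs_uniq i : uniq (right_nbrs i).
Proof. by rewrite sort_uniq filter_uniq ?iota_uniq. Qed.

Definition edges := [seq p <- [seq (i, j) | i <- iota 0 n.+1, j <- iota 0 n.+1] | right_edge p].

Lemma mem_edges p : (p \in edges) = right_edge p.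
Proof.
rewrite mem_filter; case hp : (right_edge p) => //; rewrite andTb.
have /andP[h1 h2] := right_edge_le hp; case: p h1 h2 {hp} => i j h1 h2;
  rewrite /= in h1 h2.
by apply: (allpairs_f (fun a b => (a, b))); rewrite mem_iota; lia.
Qed.

Lemma edges_uniq : uniq edges.
Proof. by rewrite filter_uniq // allpairs_uniq ?iota_uniq // => -[? ?] [? ?]. Qed.

Definition low_edges k := ksort (height^~ (x k))
  [seq p <- edges | (p.1 < k < p.2)%N && (height p (x k) < y k)].
Definition high_edges k := ksort (height^~ (x k))
  [seq p <- edges | (p.1 < k < p.2)%N && (y k < height p (x k))].
(** To the left of a vertex the edge of larger slope is the lower one, hence the reversal. *)
Definition ending_edges k := [seq (j, k) | j <- rev (left_nbrs k)].
Definition starting_edges k := [seq (k, j) | j <- right_nbrs k].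
(** Sorted at the middle of the strip between vertices [k - 1] and [k]; the list is empty for
    [k = 0]. *)
Definition sweep_edges k := ksort (height^~ ((x k.-1 + x k) / 2))
  [seq p <- edges | (p.1 < k <= p.2)%N].

Lemma mem_low_edges k p : (p \in low_edges k) =
  [&& right_edge p, (p.1 < k < p.2)%N & height p (x k) < y k].
Proof. by rewrite mem_sort mem_filter mem_edges andbC. Qed.

Lemma mem_high_edges k p : (p \in high_edges k) =
  [&& right_edge p, (p.1 < k < p.2)%N & y k < height p (x k)].
Proof. by rewrite mem_sort mem_filter mem_edges andbC. Qed.

Lemma mem_sweep_edges k p : (p \in sweep_edges k) = right_edge p && (p.1 < k <= p.2)%N.
Proof. by rewrite mem_sort mem_filter mem_edges andbC. Qed.

Lemma mem_ending_edges k p : (p \in ending_edges k) = right_edge p && (p.2 == k).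
Proof.
apply/mapP/andP => [[j]|[/andP[ep lp] /eqP pk]].
  by rewrite mem_rev mem_left_nbrs => /andP[ej jk ->] /=;
    rewrite /right_edge /= (e_sym D) ej.
exists p.1; last by rewrite -pk; case: p {ep lp pk}.
by rewrite mem_rev mem_left_nbrs -pk (e_sym D) ep.
Qed.

Lemma mem_starting_edges k p : (p \in starting_edges k) = right_edge p && (p.1 == k).
Proof.
apply/mapP/andP => [[j]|[/andP[ep lp] /eqP pk]].
  by rewrite mem_right_nbrs => /andP[ej jk ->] /=; rewrite /right_edge /= ej.
by exists p.2; rewrite ?mem_right_nbrs -pk ?ep //; case: p {ep lp pk}.
Qed.

Lemma over_between p k z : right_edge p -> (p.1 < k <= p.2)%N ->
  x k.-1 < z < x k -> strictly_over p z.
Proof.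
move=> hp /andP[pk kp] /andP[z1 z2]; have /andP[_ pn] := right_edge_le hp.
rewrite /strictly_over; apply/andP; split.
  by apply: le_lt_trans z1; apply: x_le; lia.
by apply: lt_le_trans z2 _; apply: x_le; lia.
Qed.

Lemma through_weakly_over p k : right_edge p -> (p.1 <= k <= p.2)%N -> weakly_over p (x k).
Proof.
move=> hp h; have := right_edge_le hp.
by move=> h'; rewrite /weakly_over !x_le //; lia.
Qed.

Lemma through_strictly_over p k : right_edge p -> (p.1 < k < p.2)%N -> strictly_over p (x k).
Proof.
move=> hp h; have := right_edge_le hp.
by move=> h'; rewrite /strictly_over !(x_mono D) //; lia.
Qed.

Lemma map_height_uniq k s : uniq s -> all right_edge s ->
  all (fun p => p.1 < k < p.2)%N s -> uniq (map (height^~ (x k)) s).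
Proof.
move=> us es ts; rewrite map_inj_in_uniq // => p q ps qs pq.
have [ep eq] := (allP es _ ps, allP es _ qs).
apply/eqP/negPn/negP => npq.
have /eqP[] := noncrossing D ep eq npq (through_strictly_over ep (allP ts _ ps))
  (through_strictly_over eq (allP ts _ qs)).
exact: pq.
Qed.

Lemma low_edges_sorted k :
  sorted (fun p q => height p (x k) < height q (x k)) (low_edges k).
Proof.
apply/ksort_lt/map_height_uniq; first exact: filter_uniq edges_uniq.
  by apply/allP => p; rewrite mem_filter mem_edges => /andP[].
by apply/allP => p; rewrite mem_filter => /andP[/andP[]].
Qed.

Lemma high_edges_sorted k :
  sorted (fun p q => height p (x k) < height q (x k)) (high_edges k).
Proof.
apply/ksort_lt/map_height_uniq; first exact: filter_uniq edges_uniq.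
  by apply/allP => p; rewrite mem_filter mem_edges => /andP[].
by apply/allP => p; rewrite mem_filter => /andP[/andP[]].
Qed.

(* M stands for the edges ending at vertex k, or for those starting there. *)
Lemma sweep_state_sorted k z M :
  (forall p, p \in low_edges k -> strictly_over p z) ->
  (forall p, p \in high_edges k -> strictly_over p z) ->
  (forall p, p \in M -> [/\ right_edge p, strictly_over p z,
     weakly_over p (x k), height p (x k) = y k & ~~ (p.1 < k < p.2)%N]) ->
  pairwise (fun p q => height p z < height q z) M ->
  sorted (fun p q => height p z < height q z) (low_edges k ++ M ++ high_edges k).
Proof.
move=> hA hB hM pM; have tr := @ltkey_trans R (nat * nat)%type (height^~ z).
have trk := @ltkey_trans R (nat * nat)%type (height^~ (x k)).
rewrite sorted_pairwise // !pairwise_cat pM /=.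
have wk p : right_edge p -> (p.1 < k < p.2)%N -> weakly_over p (x k).
  by move=> hp h; apply: through_weakly_over => //; lia.
have inner s : {in s, forall p, [/\ right_edge p, (p.1 < k < p.2)%N & strictly_over p z]} ->
    pairwise (fun p q => height p (x k) < height q (x k)) s ->
    pairwise (fun p q => height p z < height q z) s.
  move=> hs pws; apply: (sub_in_pairwise (P := [in s])) (pws) => [p q ps qs lt|];
    last exact/allP.
  have [[r1 t1 o1] [r2 t2 o2]] := (hs _ ps, hs _ qs).
  apply: height_lt_transfer (lt); rewrite ?wk //.
  by apply: contraTneq lt => ->; rewrite ltxx.
rewrite inner; last 2 first.
- by move=> p pA; move: (pA) (hA p pA); rewrite mem_low_edges => /and3P[].
- by rewrite -sorted_pairwise // low_edges_sorted.
rewrite inner; last 2 first.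
- by move=> p pA; move: (pA) (hB p pA); rewrite mem_high_edges => /and3P[].
- by rewrite -sorted_pairwise // high_edges_sorted.
rewrite !andbT /allrel; apply/andP; split.
  apply/allP => p pA; have op := hA p pA; move: pA;
    rewrite mem_low_edges => /and3P[r1 t1 lt1].
  apply/allP => q; rewrite mem_cat => /orP[/hM[r2 o2 w2 h2 nt2]|qB].
    apply: (height_lt_transfer r1 r2) (wk p r1 t1) w2 op o2 _; last by rewrite h2.
    by apply: contraNneq nt2 => <-.
  have oq := hB q qB; move: qB; rewrite mem_high_edges => /and3P[r2 t2 lt2].
  apply: (height_lt_transfer r1 r2) (wk p r1 t1) (wk q r2 t2) op oq (lt_trans lt1 lt2).
  by apply: contraTneq (lt_trans lt1 lt2) => ->; rewrite ltxx.
apply/allP => p /hM[r2 o2 w2 h2 nt2]; apply/allP => q qB.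
have oq := hB q qB; move: qB; rewrite mem_high_edges => /and3P[r1 t1 lt1].
apply: (height_lt_transfer r2 r1) w2 (wk q r1 t1) o2 oq _; last by rewrite h2.
by apply: contraNneq nt2 => ->.
Qed.

(** A sorted list is determined by its members, so it suffices that the right-hand side is sorted at
    the middle of the strip. Edges passing by vertex [k] keep their order from its abscissa; edges
    ending there are ordered by slope. *)
Lemma sweep_edges_before k : (k <= n)%N ->
  sweep_edges k = low_edges k ++ ending_edges k ++ high_edges k.
Proof.
move=> kn; have [->|k0] := posnP k.
  by rewrite /sweep_edges /low_edges /high_edges /ending_edges /left_nbrs /=
    !(eq_filter (a2 := pred0)) ?filter_pred0 //= => p; rewrite ltn0.
have lt : x k.-1 < x k by apply: (x_mono D); lia.
set z := (x k.-1 + x k) / 2.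
have zb : x k.-1 < z < x k by rewrite /z; apply/andP; split; lra.
apply: ksort_eq.
- exact: filter_uniq edges_uniq.
- move=> p; rewrite !mem_cat mem_low_edges mem_high_edges mem_ending_edges.
  rewrite mem_filter mem_edges andbC.
  case hp : (right_edge p) => //=.
  case: (ltngtP k p.2) => [kp|kp|->]; rewrite ?andbF //= ?andbT ?orbF.
    case: ltnP => //= pk; have := off_vertices D hp (k := k).
    by rewrite pk kp => /(_ isT) /lt_total.
  by have /andP[-> _] := right_edge_le hp; rewrite ?orbT.
apply: sweep_state_sorted => [p|p|p|].
- by rewrite mem_low_edges => /and3P[hp /andP[h1 h2] _]; apply: over_between zb;
    rewrite ?h1 ?leqW ?(ltnW h2).
- by rewrite mem_high_edges => /and3P[hp /andP[h1 h2] _]; apply: over_between zb;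
    rewrite ?h1 ?leqW ?(ltnW h2).
- rewrite mem_ending_edges => /andP[hp /eqP pk]; have /andP[h1 h2] := right_edge_le hp.
  split=> //.
  + by apply: over_between zb; rewrite // -pk h1 leqnn.
  + by apply: through_weakly_over; rewrite // -pk (ltnW h1) leqnn.
  + by rewrite -pk height2.
  + by rewrite -pk ltnn andbF.
rewrite /ending_edges pairwise_map.
have tr : transitive (fun j i => edge_slope k i < edge_slope k j) by move=> a b c h1 h2; exact: lt_trans h2 h1.
have : sorted (fun j i => edge_slope k i < edge_slope k j) (rev (left_nbrs k)).
  by rewrite rev_sorted left_nbrs_sorted.
rewrite sorted_pairwise // => pws.
have hl i : i \in [in rev (left_nbrs k)] -> e k i && (i < k)%N.
  by rewrite -mem_left_nbrs -mem_rev.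
apply: (sub_in_pairwise (P := [in rev (left_nbrs k)])) (pws) => [i j|]; last exact/allP.
move=> /hl/andP[ei ik] /hl/andP[ej jk] lt'; rewrite /= !height_end //=;
  rewrite /right_edge /= 1?e_sym ?ei ?ej //.
by rewrite ltrD2l ltr_nM2r // subr_lt0; case/andP: zb.
Qed.

Lemma sweep_edges_after k : (k < n)%N ->
  sweep_edges k.+1 = low_edges k ++ starting_edges k ++ high_edges k.
Proof.
move=> kn.
have lt : x k < x k.+1 by apply: (x_mono D); lia.
rewrite /sweep_edges /=; set z := (x k + x k.+1) / 2.
have zb : x k.+1.-1 < z < x k.+1 by rewrite /z /=; apply/andP; split; lra.
apply: ksort_eq.
- exact: filter_uniq edges_uniq.
- move=> p; rewrite !mem_cat mem_low_edges mem_high_edges mem_starting_edges.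
  rewrite mem_filter mem_edges andbC ltnS.
  case hp : (right_edge p) => //=.
  case: (ltngtP k p.1) => [kp|kp|->]; rewrite ?andbF //= ?andbT ?orbF.
    case: ltnP => //= pk; have := off_vertices D hp (k := k).
    by rewrite pk kp => /(_ isT) /lt_total.
  by have /andP[-> _] := right_edge_le hp; rewrite ?orbT.
apply: sweep_state_sorted => [p|p|p|].
- by rewrite mem_low_edges => /and3P[hp /andP[h1 h2] _]; apply: over_between zb;
    rewrite ?h1 ?leqW ?(ltnW h2).
- by rewrite mem_high_edges => /and3P[hp /andP[h1 h2] _]; apply: over_between zb;
    rewrite ?h1 ?leqW ?(ltnW h2).
- rewrite mem_starting_edges => /andP[hp /eqP pk]; have /andP[h1 h2] := right_edge_le hp.
  split=> //.
  + by apply: over_between zb; rewrite // -pk h1 leqnn.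
  + by apply: through_weakly_over; rewrite // -pk (ltnW h1) leqnn.
  + by rewrite -pk height1.
  + by rewrite -pk ltnn.
rewrite /starting_edges pairwise_map.
have tr : transitive (fun j i => edge_slope k j < edge_slope k i) by move=> a b c;
  apply: lt_trans.
have := right_nbrs_sorted k.
rewrite sorted_pairwise //; apply: sub_pairwise => i j lt'.
by rewrite /height /= ltrD2l ltr_pM2r // subr_gt0; case/andP: zb.
Qed.

Lemma drawing_labelling : exists lo up b t,
  (forall k, (k <= n)%N -> chain lo up (b k) (ending_edges k) (t k) &&
                           chain lo up (b k) (starting_edges k) (t k)) /\
  (forall c, charge up starting_edges t n.+1 c <= if c == 0%N then -1 else 1).
Proof.
apply: (@sweep_labelling _ n low_edges ending_edges starting_edges high_edges
  sweep_edges fst sweep_edges_before sweep_edges_after).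
- by rewrite /sweep_edges (eq_filter (a2 := pred0)) ?filter_pred0.
- have none (s : seq (nat * nat)) : (forall p, p \notin s) -> s = [::].
    by case: s => // p s /(_ p); rewrite mem_head.
  apply: none => p; rewrite !mem_cat mem_low_edges mem_high_edges mem_starting_edges.
  case hp : (right_edge p) => //=; have := right_edge_le hp => h.
  by rewrite (_ : (n < p.2)%N = false) ?andbF /= ?orbF; [apply/negP => /eqP|]; lia.
- by move=> k p _; rewrite mem_starting_edges => /andP[_ /eqP].
- by move=> k p _; rewrite mem_sweep_edges => /and3P[].
- by move=> k; rewrite map_inj_uniq ?right_nbrs_uniq // => i j [].
Qed.

End Drawing.

(** * Angles and discharging *)

Section ChainCycle.
Variable T : eqType.
Implicit Types (lo up : T -> nat) (s : seq T).

Lemma chain_map (T' : eqType) (f : T' -> T) lo up c (r : seq T') c' :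
  chain lo up c (map f r) c' = chain (lo \o f) (up \o f) c r c'.
Proof. by elim: r c => //= j r IH c; rewrite IH. Qed.

Lemma chain_rev lo up c s c' : chain lo up c s c' -> chain up lo c' (rev s) c.
Proof.
elim: s c => [|j s IH] c /=; first by rewrite eq_sym.
move=> /andP[/eqP <- /IH h]; rewrite rev_cons -cats1; apply/chain_cat.
by exists (up j) => //=; rewrite !eqxx.
Qed.

Lemma chain_nth lo up z c s c' k : chain lo up c s c' -> k < size s ->
  up (nth z s k) = if k.+1 < size s then lo (nth z s k.+1) else c'.
Proof.
elim: s c k => [|j s IH] c k //= /andP[_ h]; case: k => [|k] /= ks.
  by case: s h {IH ks} => [/eqP|j' s /= /andP[/eqP]].
by rewrite (IH _ _ h ks).
Qed.

Lemma chain_last lo up z c s c' : chain lo up c s c' -> s != [::] ->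
  up (last z s) = c'.
Proof.
move=> h s0; have s0' : 0 < size s by rewrite lt0n size_eq0.
rewrite -nth_last (chain_nth _ h); first by rewrite prednK // ltnn.
by rewrite prednK.
Qed.

Lemma eq_last (z : T) s j : uniq s -> j \in s ->
  (j == last z s) = ~~ ((index j s).+1 < size s).
Proof.
move=> us js; have ks : index j s < size s by rewrite index_mem.
rewrite -{1}(nth_index z js) -nth_last nth_uniq //; lia.
Qed.

Lemma nextE (z : T) s j : uniq s -> j \in s ->
  next s j = if j == last z s then head z s else nth z s (index j s).+1.
Proof.
move=> us js; rewrite next_nth js; case: s us js => // y s us js.
have : index j (y :: s) < size (y :: s) by rewrite index_mem.
set k := index j (y :: s) => ks.
rewrite (eq_last z) // -/k; case: ltnP => /= kN.
  by apply: set_nth_default; rewrite -ltnS.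
by rewrite nth_default.
Qed.

Lemma chain_next lo up c s j : uniq s -> chain lo up c s c -> j \in s ->
  lo (next s j) = up j.
Proof.
move=> us h js; rewrite (nextE j) //.
have ks : index j s < size s by rewrite index_mem.
have := chain_nth j h ks; rewrite nth_index // => ->.
rewrite eq_last //.
case: ltnP => //= _.
by case: (s) js h => //= j' s' _ /andP[/eqP].
Qed.

End ChainCycle.

Lemma next_key_lt (R : realType) (T : eqType) (z : T) (f : T -> R) s j :
  sorted (fun a b => f a < f b)%R s -> (1 < size s)%N -> j \in s ->
  if j == last z s then (f (next s j) < f j)%R else (f j < f (next s j))%R.
Proof.
move=> ss sz js.
have us : uniq s.
  by apply: (map_uniq (f := f)); apply: lt_sorted_uniq; rewrite sorted_map.
have mono k l : (k < l < size s)%N -> (f (nth z s k) < f (nth z s l))%R.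
  by move=> /andP[kl ls]; apply: (sorted_ltn_nth (@ltkey_trans _ _ f) z ss);
    rewrite ?inE // (ltn_trans kl).
have ks : (index j s < size s)%N by rewrite index_mem.
rewrite (nextE z) // eq_last //; case: ltnP => /= hk.
  by rewrite -[X in (f X < _)%R](nth_index z js); apply: mono; lia.
by rewrite -nth0 -[X in (_ < f X)%R](nth_index z js); apply: mono; lia.
Qed.

(** * Cosines and sines of corner angles *)

Section Trigonometry.
Variable R : realType.
Local Open Scope ring_scope.

(** For [c = cos (pi / 3)] the triple angle formula gives [4 c^3 - 3 c = -1], that is
    [(c + 1) (2 c - 1)^2 = 0], and [c] is positive. *)
Lemma cos_pi3 : cos (pi / 3 : R) = 2^-1.
Proof.
have p0 := @pi_gt0 R.
have c0 : 0 < cos (pi / 3 : R) by apply: cos_gt0_pihalf; apply/andP; split; lra.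
have : cos (pi / 3 *+ 2 + pi / 3 : R) = - 1.
  by rewrite -cospi; congr cos; field.
rewrite cosD cos_mulr2n sin_mulr2n.
have := sin2cos2 (pi / 3 : R).
move: c0; move: (cos _) (sin _) => c s c0 s2 h.
have {}h : 4 * c ^+ 3 - 3 * c = - 1.
  have cs : c * s *+ 2 * s = 2 * c * s ^+ 2 by ring.
  by rewrite -h cs s2; ring.
have : (c + 1) * (2 * c - 1) ^+ 2 = 0.
  by transitivity (4 * c ^+ 3 - 3 * c + 1); [ring | rewrite h; ring].
by move=> /eqP; rewrite mulf_eq0 sqrf_eq0 => /orP[] /eqP ?; lra.
Qed.

Lemma cos_gt_half (a : R) : 0 < a < pi / 3 -> 2^-1 < cos a.
Proof.
move=> /andP[a0 a1]; rewrite -cos_pi3 ltr_cos // in_itv /=; have := @pi_gt0 R; lra.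
Qed.

Lemma angle_eq (a b : R) : 0 < a < pi -> 0 < b < pi *+ 2 ->
  cos a = cos b -> sin a = sin b -> a = b.
Proof.
move=> /andP[a0 a1] /andP[b0 b1] c s.
have [bp|bp] := ltP b pi.
  by apply: cos_inj => //; rewrite in_itv /= !ltW.
have := @sin_gt0_pi R a; rewrite a0 a1 s => /(_ isT).
have : 0 <= sin (b - pi) by apply: sin_ge0_pi; rewrite mulr2n in b1; lra.
by rewrite sinB cospi sinpi; lra.
Qed.

End Trigonometry.

(** Serves to show that opposite corners of a four-sided face agree. The ends of each diagonal are
    told apart by abscissa, as vertices of a drawing can be. *)
Lemma rhombus_parallelogram (R : realType) (p q r s : R * R) (l : R) :
  ((q.1 - p.1) ^+ 2 + (q.2 - p.2) ^+ 2 = l)%R ->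
  ((s.1 - p.1) ^+ 2 + (s.2 - p.2) ^+ 2 = l)%R ->
  ((q.1 - r.1) ^+ 2 + (q.2 - r.2) ^+ 2 = l)%R ->
  ((s.1 - r.1) ^+ 2 + (s.2 - r.2) ^+ 2 = l)%R ->
  p.1 != r.1 -> q.1 != s.1 ->
  (p.1 + r.1 = q.1 + s.1 /\ p.2 + r.2 = q.2 + s.2)%R.
Proof.
case: p q r s => [p1 p2] [q1 q2] [r1 r2] [s1 s2] /= h1 h2 h3 h4 pr qs.
(* w is orthogonal to the two diagonals u and v, which are orthogonal to each
   other, so it vanishes. *)
pose w1 := (p1 + r1 - (q1 + s1))%R; pose w2 := (p2 + r2 - (q2 + s2))%R.
pose u1 := (q1 - s1)%R; pose u2 := (q2 - s2)%R.
pose v1 := (p1 - r1)%R; pose v2 := (p2 - r2)%R.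
have wu : (w1 * u1 + w2 * u2 = 0)%R by rewrite /w1 /w2 /u1 /u2; lra.
have wv : (w1 * v1 + w2 * v2 = 0)%R by rewrite /w1 /w2 /v1 /v2; lra.
have uv : (u1 * v1 + u2 * v2 = 0)%R by rewrite /u1 /u2 /v1 /v2; lra.
have u0 : u1 != 0%R by rewrite subr_eq0.
have v0 : v1 != 0%R by rewrite subr_eq0.
(* By the identity [|u|^2 |v|^2 = (u . v)^2 + det^2], orthogonal nonzero vectors are independent. *)
have det : (u1 * v2 - u2 * v1 != 0)%R.
  apply/eqP => d0.
  have /eqP : ((u1 ^+ 2 + u2 ^+ 2) * (v1 ^+ 2 + v2 ^+ 2) = 0)%R.
    transitivity ((u1 * v1 + u2 * v2) ^+ 2 + (u1 * v2 - u2 * v1) ^+ 2)%R; first by ring.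
    by rewrite uv d0; ring.
  by rewrite mulf_eq0 !paddr_eq0 ?sqr_ge0 // !sqrf_eq0 (negPf u0) (negPf v0).
have w10 : w1 = 0%R.
  apply: (mulIf det); rewrite mul0r.
  transitivity ((w1 * u1 + w2 * u2) * v2 - (w1 * v1 + w2 * v2) * u2)%R; first by ring.
  by rewrite wu wv; ring.
have w20 : w2 = 0%R.
  apply: (mulIf det); rewrite mul0r.
  transitivity ((w1 * v1 + w2 * v2) * u1 - (w1 * u1 + w2 * u2) * v1)%R; first by ring.
  by rewrite wu wv; ring.
by split; apply/eqP; rewrite -subr_eq0 ?w10 ?w20; apply/eqP.
Qed.

(** * Corner angles and walks around faces *)

Section Discharging.
Variables (R : realType) (n : nat) (x y : nat -> R) (e : rel nat) (l : R).
Local Open Scope ring_scope.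
Hypothesis D : drawing n x y e.
Hypothesis l0 : 0 < l.
Hypothesis len : forall i j, e i j -> (x j - x i) ^+ 2 + (y j - y i) ^+ 2 = l ^+ 2.

Local Notation slope := (edge_slope x y).

(* The neighbours of i in counterclockwise order, starting from the vertical
   upward direction. *)
Definition nbrs i := left_nbrs x y e i ++ right_nbrs n x y e i.

Hypothesis deg : forall i, (i <= n)%N -> size (nbrs i) = 5.

Lemma mem_nbrs i j : (j \in nbrs i) = e i j.
Proof.
rewrite mem_cat mem_left_nbrs (mem_right_nbrs D) -andb_orr orbC -neq_ltn.
by case: eqVneq => [->|]; rewrite ?(e_irr D) ?andbT.
Qed.

Lemma nbrs_uniq i : uniq (nbrs i).
Proof.
rewrite cat_uniq left_nbrs_uniq right_nbrs_uniq andbT /=.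
apply/hasPn => j; rewrite (mem_right_nbrs D) mem_left_nbrs => /andP[_ ij].
by rewrite negb_and -leqNgt (ltnW ij) orbT.
Qed.

(* The direction of the dart i -> j, measured from the opposite of the x-axis. *)
Definition theta i j : R := atan (slope i j) + (if (i < j)%N then pi else 0).

Lemma theta_sorted i : sorted (fun a b => theta i a < theta i b) (nbrs i).
Proof.
have tr := @ltkey_trans R nat (theta i).
have trs := @ltkey_trans R nat (slope i).
rewrite sorted_pairwise // pairwise_cat.
have sub s : (forall a b, a \in s -> b \in s -> (i < a)%N = (i < b)%N) ->
    sorted (fun a b => slope i a < slope i b) s ->
    pairwise (fun a b => theta i a < theta i b) s.
  move=> hs; rewrite sorted_pairwise // => pws.
  apply: (sub_in_pairwise (P := [in s])) (pws) => [a b sa sb lt|]; last exact/allP.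
  by rewrite /theta (hs a b sa sb) ltrD2r lt_atan.
rewrite !sub ?(left_nbrs_sorted D) ?(right_nbrs_sorted D) //.
- rewrite !andbT; apply/allP => a; rewrite mem_left_nbrs => /andP[_ ai].
  apply/allP => b; rewrite (mem_right_nbrs D) => /andP[_ ib].
  rewrite /theta ib ltnNge (ltnW ai) /=.
  have := atan_ltpi2 (slope i a); have := atan_gtNpi2 (slope i b).
  by have := @pi_gt0 R; lra.
- by move=> a b; rewrite !(mem_right_nbrs D) => /andP[_ ->] /andP[_ ->].
- by move=> a b; rewrite !mem_left_nbrs => /andP[_ /ltnW h] /andP[_ /ltnW h'];
    rewrite !ltnNge h h'.
Qed.

Lemma theta_bounds i j : - (pi / 2) < theta i j < pi / 2 + pi.
Proof.
have := atan_ltpi2 (slope i j); have := atan_gtNpi2 (slope i j).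
by rewrite /theta; have := @pi_gt0 R; case: ifP => _ *; apply/andP; split; lra.
Qed.

Definition nextn i j := next (nbrs i) j.
(* One step backwards along the face to the left of the dart d. *)
Definition psi (d : nat * nat) := (nextn d.1 d.2, d.1).
(* The corner following d contains the upward vertical direction, where theta jumps. *)
Definition wrap (d : nat * nat) := d.2 == last 0%N (nbrs d.1).
(** The counterclockwise angle from [d] to the next dart at its origin: the corner to the left of
    [d]. *)
Definition alpha (d : nat * nat) : R :=
  theta d.1 (nextn d.1 d.2) - theta d.1 d.2 + (wrap d)%:R * (pi *+ 2).
Definition dart (d : nat * nat) := e d.1 d.2.

Lemma dart_le d : dart d -> (d.1 <= n)%N /\ (d.2 <= n)%N.
Proof. by move=> h; split; [exact: e_le D _ _ h | apply: (e_le D (j := d.1));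
  rewrite (e_sym D)]. Qed.

Lemma nextn_edge i j : e i j -> e i (nextn i j).
Proof. by rewrite -!mem_nbrs mem_next. Qed.

Lemma dart_psi d : dart d -> dart (psi d).
Proof. by move=> h; rewrite /dart /= (e_sym D) nextn_edge. Qed.

Lemma nextn_inj i j k : nextn i j = nextn i k -> j = k.
Proof. by move=> /(congr1 (prev (nbrs i))); rewrite !prev_next ?nbrs_uniq. Qed.

Lemma psi_inj : injective psi.
Proof. by move=> [i j] [i' j'] [h ii']; rewrite /= -ii' in h *;
  rewrite (nextn_inj h). Qed.

Lemma nextn_key i j : e i j -> if wrap (i, j)
  then theta i (nextn i j) < theta i j else theta i j < theta i (nextn i j).
Proof.
move=> eij; apply: next_key_lt; rewrite ?mem_nbrs ?theta_sorted //.
by rewrite deg // (e_le D eij).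
Qed.

Lemma nextn_neq i j : e i j -> nextn i j != j.
Proof.
by move=> /nextn_key; apply: contraTneq => ->; rewrite ltxx if_same.
Qed.

Lemma alpha_bounds d : dart d -> 0 < alpha d < pi *+ 2.
Proof.
case: d => i j /= h; have := nextn_key h; rewrite /alpha /=.
have := theta_bounds i j; have := theta_bounds i (nextn i j).
case: (wrap (i, j)); rewrite ?mul1r ?mul0r /= => /andP[? ?] /andP[? ?] ?;
  by apply/andP; split; lra.
Qed.

(** The minus signs come from measuring [theta] from the opposite of the x-axis. The edge length
    fixes the modulus of the abscissa difference, the order of the indices its sign. *)
Lemma dart_vector i j : e i j ->
  x j - x i = - l * cos (theta i j) /\ y j - y i = - l * sin (theta i j).
Proof.
move=> eij; set s := slope i j; set c := cos (atan s).
have c0 : 0 < c by apply: cos_gt0_pihalf; rewrite atan_gtNpi2 atan_ltpi2.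
have sE : sin (atan s) = s * c.
  by rewrite -{2}(atanK s) /tan mulfVK // lt0r_neq0.
have cs : c ^+ 2 * (1 + s ^+ 2) = 1.
  by rewrite -[RHS](cos2Dsin2 (atan s)) sE -/c; ring.
have ij : i != j by apply: contraTneq eij => ->; rewrite (e_irr D).
have [iln jln] := dart_le (d := (i, j)) eij; rewrite /= in iln jln.
have dx : if (i < j)%N then 0 < x j - x i else x j - x i < 0.
  case: ltngtP ij => // h _; first by rewrite subr_gt0 (x_mono D) // h.
  by rewrite subr_lt0 (x_mono D) // h.
have dx0 : x j - x i != 0.
  by move: dx; case: ifP => _ h; [exact: lt0r_neq0 | exact: ltr0_neq0].
have dy : y j - y i = s * (x j - x i) by rewrite /s /edge_slope mulfVK.
have dxl : (x j - x i) ^+ 2 = (l * c) ^+ 2.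
  apply: (mulIf (x := 1 + s ^+ 2)).
    by apply: lt0r_neq0; rewrite ltr_pwDl // sqr_ge0.
  transitivity (l ^+ 2 * (c ^+ 2 * (1 + s ^+ 2))); last by ring.
  by rewrite cs mulr1 -(len eij) dy; ring.
have lc : 0 < l * c by rewrite mulr_gt0.
have dxE : x j - x i = (if (i < j)%N then 1 else -1) * (l * c).
  have /eqP := dxl; rewrite eqf_sqr => /orP[] /eqP h; move: dx; rewrite h;
    case: ifP => _; rewrite ?mul1r ?mulN1r //; lra.
rewrite dy dxE /theta -/s; case: ifP => _.
  by rewrite cosDpi sinDpi sE -/c; split; ring.
by rewrite addr0 sE -/c; split; ring.
Qed.

(** The inner product of two vectors of length [l]; [alpha_sin] is their determinant. *)
Lemma alpha_cos d : dart d -> let i := d.1 in let j := d.2 in let k := nextn i j in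
  l ^+ 2 * cos (alpha d) = (x j - x i) * (x k - x i) + (y j - y i) * (y k - y i).
Proof.
case: d => i j /= h.
have [-> ->] := dart_vector h; have [-> ->] := dart_vector (nextn_edge h).
have -> : cos (alpha (i, j)) = cos (theta i (nextn i j) - theta i j).
  by rewrite /alpha /=; case: (wrap _); rewrite ?mul1r ?mul0r ?addr0 ?cosD2pi.
by rewrite cosB; ring.
Qed.

Lemma alpha_sin d : dart d -> let i := d.1 in let j := d.2 in let k := nextn i j in
  l ^+ 2 * sin (alpha d) = (x j - x i) * (y k - y i) - (y j - y i) * (x k - x i).
Proof.
case: d => i j /= h.
have [-> ->] := dart_vector h; have [-> ->] := dart_vector (nextn_edge h).
have -> : sin (alpha (i, j)) = sin (theta i (nextn i j) - theta i j).
  by rewrite /alpha /=; case: (wrap _); rewrite ?mul1r ?mul0r ?addr0 ?sinD2pi.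
by rewrite sinB; ring.
Qed.

Lemma psi_neq d : dart d -> psi d != d.
Proof.
case: d => i j h; apply/eqP => -[_ ij]; move: h; rewrite /dart /= ij.
by rewrite (e_irr D).
Qed.

Lemma psi2_neq d : dart d -> psi (psi d) != d.
Proof.
case: d => i j h; apply/eqP => -[_ /= ij].
by have := nextn_neq h; rewrite ij eqxx.
Qed.

(** A walk closing after three darts runs round an equilateral triangle, whose corners have cosine
    1/2; an angle below [pi / 3] has a larger cosine. *)
Lemma psi3_neq d : dart d -> alpha d < pi / 3 -> psi (psi (psi d)) != d.
Proof.
case: d => i j h small; apply/eqP => -[_ /= jE].
have h1 : e i (nextn i j) := nextn_edge h.
have h2 : e (nextn i j) j by rewrite -[X in e _ X]jE nextn_edge // (e_sym D).
have := alpha_cos h => /= c.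
have /andP[a0 _] := alpha_bounds h.
have : 2^-1 < cos (alpha (i, j)) by apply: cos_gt_half; rewrite a0.
have := len h; have := len h1; have := len h2 => L2 L1 L0 c2.
have l2 : 0 < l ^+ 2 by rewrite exprn_gt0.
have : l ^+ 2 * cos (alpha (i, j)) = l ^+ 2 / 2 by rewrite c; lra.
by move: (cos _) c2 => C c2; nra.
Qed.

(** The walk runs round a rhombus, hence a parallelogram; opposite corners have the same inner
    product and determinant, so the same angle. *)
Lemma psi4_small d : dart d -> alpha d < pi / 3 -> psi (psi (psi (psi d))) = d ->
  alpha (psi (psi d)) < pi / 3.
Proof.
move=> hd small; have hd2 : dart (psi (psi d)) by do 2!apply: dart_psi.
case: d hd small hd2 => i j h small hd2 [_ jE].
set j1 := nextn i j in hd2 jE *; set j2 := nextn j1 i in hd2 jE *.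
rewrite /= in jE.
have h1 : e i j1 := nextn_edge h.
have h1' : e j1 i by rewrite (e_sym D).
have h2 : e j1 j2 := nextn_edge h1'.
have h2' : e j2 j1 by rewrite (e_sym D).
have h3 : e j2 j by rewrite -jE; apply: nextn_edge.
have n1 : j1 != j := nextn_neq h.
have n2 : j2 != i := nextn_neq h1'.
have xneq a b : (a <= n)%N -> (b <= n)%N -> a != b -> x a != x b.
  move=> an bn; rewrite neq_ltn => /orP[] lt.
    by rewrite lt_eqF // (x_mono D) // lt.
  by rewrite gt_eqF // (x_mono D) // lt.
have [E1 E2] : (x i + x j2 = x j + x j1 /\ y i + y j2 = y j + y j1).
  apply: (@rhombus_parallelogram R (x i, y i) (x j, y j) (x j2, y j2) (x j1, y j1) (l ^+ 2)) => /=;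
    rewrite ?len //; apply: xneq; rewrite 1?[_ == j1]eq_sym 1?[_ == j2]eq_sym //.
  - exact: e_le D _ _ h.
  - exact: e_le D _ _ h3.
  - by apply: (e_le D (j := i)); rewrite (e_sym D).
  - exact: e_le D _ _ h2.
have F1 : x j2 = x j + x j1 - x i by rewrite -E1; ring.
have F2 : y j2 = y j + y j1 - y i by rewrite -E2; ring.
have l2 : l ^+ 2 != 0 by rewrite expf_neq0 // lt0r_neq0.
have /andP[a0 _] := alpha_bounds h.
have <- : alpha (i, j) = alpha (psi (psi (i, j))); last by [].
have p0 := @pi_gt0 R.
apply: angle_eq; rewrite ?alpha_bounds //.
- by rewrite a0; lra.
- apply: (mulfI l2); rewrite !alpha_cos //= -/j1 -/j2 jE.
  by rewrite F1 F2; ring.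
- apply: (mulfI l2); rewrite !alpha_sin //= -/j1 -/j2 jE.
  by rewrite F1 F2; ring.
Qed.

Definition darts := [seq (i, j) | i <- index_iota 0 n.+1, j <- nbrs i].

Lemma mem_darts d : (d \in darts) = dart d.
Proof.
apply/allpairsPdep/idP => [[i [j [_]]]|h].
  by rewrite mem_nbrs => ? ->.
exists d.1, d.2; rewrite mem_nbrs mem_index_iota ltnS; split=> //; last by case: d h.
by case: (dart_le h).
Qed.

Lemma darts_uniq : uniq darts.
Proof.
apply: allpairs_uniq_dep; first exact: iota_uniq.
  by move=> i _; exact: nbrs_uniq.
by move=> [i j] [i' j'] _ _ [/= -> ->].
Qed.

Lemma perm_psi_darts : perm_eq (map psi darts) darts.
Proof.
have u : uniq (map psi darts) by rewrite (map_inj_uniq psi_inj) darts_uniq.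
have sub : {subset map psi darts <= darts}.
  by move=> _ /mapP[d + ->]; rewrite !mem_darts; apply: dart_psi.
apply: uniq_perm => //; first exact: darts_uniq.
by have [] := uniq_min_size u sub; rewrite ?size_map.
Qed.

Lemma sum_darts (F : nat * nat -> R) :
  \sum_(d <- darts) F d = \sum_(0 <= i < n.+1) \sum_(j <- nbrs i) F (i, j).
Proof. by rewrite big_allpairs_dep. Qed.

Lemma count_darts (P : pred (nat * nat)) :
  count P darts = (\sum_(0 <= i < n.+1) count (fun j => P (i, j)) (nbrs i))%N.
Proof.
rewrite -sum1_count big_mkcond big_allpairs_dep; apply: eq_bigr => i _.
by rewrite -big_mkcond sum1_count.
Qed.

Definition is_right (d : nat * nat) := (d.1 < d.2)%N.

(** A dart gets the label on its left: the upper side of an edge run rightwards, the lower side of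
    one run leftwards. Charge then counts right-going darts minus darts with [wrap]. *)
Lemma dart_labelling : exists lab : nat * nat -> nat,
  (forall d, dart d -> lab (psi d) = lab d) /\
  (forall c, (count (fun d => (lab d == c) && is_right d) darts)%:Z -
     (count (fun d => (lab d == c) && wrap d) darts)%:Z <= if c == 0%N then -1 else 1).
Proof.
have [lo [up [b [t [corner chg]]]]] := drawing_labelling D.
pose lab (d : nat * nat) := if (d.1 < d.2)%N then up d else lo (d.2, d.1).
(* Counterclockwise from the upward vertical, left neighbours come top down, hence [chain_rev], and
   right ones bottom up; the circuit starts and ends in the gap labelled [t i]. *)
have cyc i : (i <= n)%N ->
    chain (fun j => lab (j, i)) (fun j => lab (i, j)) (t i) (nbrs i) (t i).
  move=> /corner /andP[]; rewrite /ending_edges /starting_edges !chain_map => hL hR.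
  apply/chain_cat; exists (b i).
    move/chain_rev: hL; rewrite revK.
    by rewrite (eq_chain (lo' := fun j => lab (j, i)) (up' := fun j => lab (i, j))) //;
      move=> j; rewrite mem_left_nbrs /lab /= => /andP[_ ji]; rewrite ?ji // ltnNge ltnW.
  move: hR;
    rewrite (eq_chain (lo' := fun j => lab (j, i)) (up' := fun j => lab (i, j))) //;
    by move=> j; rewrite (mem_right_nbrs D) /lab /= => /andP[_ ji];
      rewrite ?ji // ltnNge ltnW.
exists lab; split=> [[i j] h|c].
  have [iln _] := dart_le h.
  by apply: (chain_next (nbrs_uniq i) (cyc i iln)); rewrite mem_nbrs.
apply: le_trans (chg c); rewrite /charge !count_darts.
have Posz_sum (F : nat -> nat) :
    (\sum_(0 <= i < n.+1) F i)%N%:Z = \sum_(0 <= i < n.+1) (F i)%:Z.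
  exact: (big_morph Posz PoszD erefl).
rewrite !Posz_sum -sumrB le_eqVlt; apply/orP; left; apply/eqP/eq_big_nat => i.
rewrite ltnS => /andP[_ iln]; congr (_ - _).
  congr (_%:Z); rewrite /nbrs count_cat [X in (X + _)%N](_ : _ = 0%N) ?add0n.
    rewrite /starting_edges -map_comp count_map; apply: eq_in_count => j.
    by rewrite (mem_right_nbrs D) /= /lab /is_right /= => /andP[_ ->]; rewrite andbT.
  apply/eqP; rewrite -leqn0 leqNgt -has_count; apply/hasPn => j.
  rewrite mem_left_nbrs /is_right /= => /andP[_ ji].
  by rewrite ltnNge (ltnW ji) andbF.
(* Exactly one dart at [i] wraps, and the label on its left is that of the gap above [i]. *)
have nz : nbrs i != [::] by rewrite -size_eq0 deg.
rewrite -(chain_last 0%N (cyc i iln) nz); congr (_%:Z); rewrite /wrap /=.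
set m := last _ _; have mi : m \in nbrs i by rewrite /m;
  case: (nbrs i) nz => // a s _; rewrite /= mem_last.
rewrite (eq_count (a2 := [pred j | (lab (i, m) == c) && (j == m)])).
  case: (_ == c) => /=; last by rewrite count_pred0.
  by rewrite (count_uniq_mem _ (nbrs_uniq i)) mi.
by move=> j /=; case: (eqVneq j m) => [->|]; rewrite ?andbF.
Qed.

Lemma sum_indicator (T : Type) (s : seq T) (P : pred T) :
  \sum_(d <- s) (P d)%:R = (count P s)%:R :> R.
Proof. by elim: s => [|d s IH]; rewrite ?big_nil ?big_cons //= IH natrD. Qed.

Lemma sum_ones (T : Type) (s : seq T) : \sum_(d <- s) 1 = (size s)%:R :> R.
Proof. by rewrite big_const_seq count_predT iter_addr_0. Qed.

(** * Excesses and gifts, summed over label classes and vertices *)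

Definition excess (d : nat * nat) : R := 3 / pi * alpha d - 1.
Definition gift (d : nat * nat) : R := Num.min 1 (Num.max 0 (excess d)).

Lemma gift_le1 d : gift d <= 1.
Proof. by rewrite ge_min lexx. Qed.

Lemma gift_ge0 d : 0 <= gift d.
Proof. by rewrite le_min ler01 le_max lexx. Qed.

Lemma gift_le_excess d : 0 <= excess d -> gift d <= excess d.
Proof. by move=> h; rewrite /gift max_r // ge_min lexx orbT. Qed.

Lemma gift_eq0 d : excess d <= 0 -> gift d = 0.
Proof. by move=> h; rewrite /gift max_l // min_r. Qed.

Lemma excess_lt0 d : (excess d < 0) = (alpha d < pi / 3).
Proof.
have p0 := pi_gt0 R.
by rewrite /excess subr_lt0 -ltr_pdivlMl ?divr_gt0 // invf_div mulr1.
Qed.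

Definition same_label (lab : nat * nat -> nat) c := [seq d <- darts | lab d == c].

Section Labelled.
Variable lab : nat * nat -> nat.
Hypothesis lab_psi : forall d, dart d -> lab (psi d) = lab d.
Local Notation cls c := (same_label lab c).

Lemma mem_same_label c d : (d \in cls c) = dart d && (lab d == c).
Proof. by rewrite mem_filter mem_darts andbC. Qed.

Lemma psi_same_label c d : d \in cls c -> psi d \in cls c.
Proof.
by rewrite !mem_same_label => /andP[h /eqP <-]; rewrite dart_psi // lab_psi // eqxx.
Qed.

Lemma sum_psi c (F : nat * nat -> R) : \sum_(d <- cls c) F (psi d) = \sum_(d <- cls c) F d.
Proof.
rewrite !big_filter -[RHS](perm_big _ perm_psi_darts) /= big_map.
rewrite big_seq_cond [RHS]big_seq_cond; apply: eq_bigl => d.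
by rewrite mem_darts; case h : (dart d) => //=; rewrite lab_psi.
Qed.

(* The difference of the two counts is the turning number of the class. *)
Lemma class_angle_sum c : \sum_(d <- cls c) alpha d =
  pi * ((size (cls c))%:R - 2 * ((count is_right (cls c))%:R - (count wrap (cls c))%:R)).
Proof.
(* [F] is [theta] of the reversed dart, since reversal shifts [theta] by [pi] up or down. The
   reverse of [psi d] is the second side of the corner of [d], so re-indexing along [psi] cancels
   the slopes. *)
pose F (d : nat * nat) := theta d.1 d.2 + pi * (1 - 2 * (is_right d)%:R).
have aE d : d \in cls c -> alpha d = F (psi d) - theta d.1 d.2 + 2 * pi * (wrap d)%:R.
  rewrite mem_same_label => /andP[h _]; rewrite /alpha /F /psi /is_right /=.
  have h' := nextn_edge h; move: (nextn d.1 d.2) h' => k h'.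
  have neq : d.1 != k by apply: contraTneq h' => ->; rewrite (e_irr D).
  rewrite /theta [slope k _]slopeC.
  by case: (ltngtP d.1 k) neq => //= _ _; ring.
rewrite big_seq (eq_bigr _ aE) -big_seq big_split /= sumrB sum_psi.
rewrite big_split /= -!mulr_sumr sumrB -mulr_sumr !sum_indicator.
by rewrite sum_ones; ring.
Qed.

Lemma class_excess_sum c : \sum_(d <- cls c) excess d =
  2 * (size (cls c))%:R - 6 * ((count is_right (cls c))%:R - (count wrap (cls c))%:R).
Proof.
rewrite sumrB -mulr_sumr class_angle_sum sum_ones.
by have := lt0r_neq0 (pi_gt0 R); move: (@pi R) => p p0; field.
Qed.

(** A small corner excludes walks of fewer than four darts. In a class of exactly four the walk
    closes up and the opposite corner is small too, giving 4 + 2; a larger class gives at least 5 +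
    1. *)
Lemma small_class c d : d \in cls c -> excess d < 0 ->
  (6 <= size (cls c) + count (fun d => (excess d < 0)%R) (cls c))%N.
Proof.
move=> d0 small; have d1 := psi_same_label d0; have d2 := psi_same_label d1.
have d3 := psi_same_label d2; have d4 := psi_same_label d3.
have [hd _] := andP (etrans (esym (mem_same_label c d)) d0).
have sm : alpha d < pi / 3 by rewrite -excess_lt0.
have n1 := psi_neq hd; have n2 := psi2_neq hd; have n3 := psi3_neq hd sm.
have us : uniq [:: d; psi d; psi (psi d); psi (psi (psi d))].
  move: n1 n2 n3; rewrite ![_ == d]eq_sym => n1' n2' n3'.
  by rewrite /= !inE !negb_or !(inj_eq psi_inj) n1' n2' n3'.
have sub : {subset [:: d; psi d; psi (psi d); psi (psi (psi d))] <= cls c}.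
  by move=> z; rewrite !inE => /or4P[] /eqP->.
have := uniq_leq_size us sub; rewrite leq_eqVlt => /orP[/eqP k4|] /=.
  have [_ eqi] := uniq_min_size us sub (eq_leq (esym k4)).
  have /eqP p4 : psi (psi (psi (psi d))) == d.
    move: d4; rewrite -eqi !inE !(inj_eq psi_inj) (negPf n1) (negPf n2) (negPf n3).
    by rewrite !orbF.
  rewrite -k4 -size_filter -[6%N]/(4 + 2)%N leq_add2l.
  apply: (@uniq_leq_size _ [:: d; psi (psi d)]).
    by rewrite /= inE eq_sym n2.
  move=> z; rewrite !inE => /orP[] /eqP->; rewrite mem_filter ?small ?d0 // d2 andbT.
  by rewrite excess_lt0 psi4_small.
have : (0 < count (fun d => (excess d < 0)%R) (cls c))%N.
  by rewrite -has_count; apply/hasP; exists d.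
by move=> m0 k5; exact: leq_add k5 m0.
Qed.

Lemma gift_sum_le c : \sum_(d <- cls c) gift d <=
  (size (cls c))%:R - (count (fun d => excess d < 0) (cls c))%:R.
Proof.
elim: (cls c) => [|d s IH]; rewrite ?big_nil ?subr0 // big_cons /=.
rewrite -[(size s).+1]addn1 !natrD; have := gift_le1 d.
by case: ltP => /= h; [rewrite (gift_eq0 (ltW h)) | ]; lra.
Qed.

(** With [k] corners, [m] of them small, the gifts add up to at most [k - m] and the excesses to at
    least [2 k - 6], so [k + m >= 6] suffices. Without small corners the comparison is termwise. *)
Lemma gift_sum_le_excess c :
  (count is_right (cls c))%:Z - (count wrap (cls c))%:Z <= 1 :> int ->
  \sum_(d <- cls c) gift d <= \sum_(d <- cls c) excess d.
Proof.
move=> tc;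
  have [/hasP[d dc small]|/hasPn all0] := boolP (has (fun d => excess d < 0) (cls c)).
  apply: le_trans (gift_sum_le c) _; rewrite class_excess_sum.
  have := small_class dc small; rewrite -(ler_nat R) natrD.
  have : (count is_right (cls c) <= count wrap (cls c) + 1)%N by lia.
  by rewrite -(ler_nat R) natrD; lra.
rewrite big_seq [leRHS]big_seq; apply: ler_sum => d /all0; rewrite -leNgt.
exact: gift_le_excess.
Qed.

(** A turning number at most -1 brings the excesses to at least [2 k + 6], while [k] gifts give at
    most [k]. *)
Lemma gift_sum_lt_excess c :
  (count is_right (cls c))%:Z - (count wrap (cls c))%:Z <= -1 :> int ->
  \sum_(d <- cls c) gift d < \sum_(d <- cls c) excess d.
Proof.
move=> tc; apply: le_lt_trans (gift_sum_le c) _; rewrite class_excess_sum.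
have : (count is_right (cls c) + 1 <= count wrap (cls c))%N by lia.
rewrite -(ler_nat R) natrD.
have := ler0n R (size (cls c)); have := ler0n R (count (fun d => excess d < 0) (cls c)).
lra.
Qed.

Lemma sum_classes (F : nat * nat -> R) M : (forall d, d \in darts -> (lab d < M)%N) ->
  \sum_(d <- darts) F d = \sum_(c < M) \sum_(d <- cls c) F d.
Proof.
move=> labM; under [RHS]eq_bigr do rewrite big_filter big_mkcond.
rewrite exchange_big /= big_seq [RHS]big_seq; apply: eq_bigr => d /labM dM.
by rewrite -big_mkcond (big_pred1 (Ordinal dM)) // => c; rewrite -val_eqE /= eq_sym.
Qed.

End Labelled.

(** The successor permutes the neighbours, so the values of [theta] cancel and the single wrapping
    corner contributes the full turn. *)
Lemma vertex_angle_sum i : (i <= n)%N -> \sum_(j <- nbrs i) alpha (i, j) = pi *+ 2.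
Proof.
move=> iln; rewrite /alpha big_split sumrB /= -mulr_suml.
have -> : \sum_(j <- nbrs i) theta i (nextn i j) = \sum_(j <- nbrs i) theta i j.
  rewrite -(big_map (nextn i) xpredT (theta i)); apply: perm_big.
  apply: uniq_perm; rewrite ?nbrs_uniq //.
    by rewrite map_inj_uniq ?nbrs_uniq // => j k; apply: nextn_inj.
  move=> j; apply/mapP/idP => [[k + ->]|ji]; first by rewrite mem_next.
  by exists (prev (nbrs i) j); rewrite ?mem_prev // /nextn next_prev ?nbrs_uniq.
rewrite subrr add0r sum_indicator /wrap /= (count_uniq_mem _ (nbrs_uniq i)).
suff -> : last 0%N (nbrs i) \in nbrs i by rewrite mul1r.
by have := deg iln; case: (nbrs i) => //= a s _; rewrite mem_last.
Qed.

Lemma vertex_excess_sum i : (i <= n)%N -> \sum_(j <- nbrs i) excess (i, j) = 1.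
Proof.
move=> iln; rewrite /excess sumrB -mulr_sumr vertex_angle_sum //.
rewrite sum_ones deg // -mulr_natl.
by have := lt0r_neq0 (pi_gt0 R); move: (@pi R) => p p0; field.
Qed.

(** If some excess reaches 1, its gift alone is 1; otherwise every gift is at least its excess. *)
Lemma vertex_gift_sum i : (i <= n)%N -> 1 <= \sum_(j <- nbrs i) gift (i, j).
Proof.
move=> iln.
have [/hasP[j ji big]|/hasPn lt1] := boolP (has (fun j => 1 <= excess (i, j)) (nbrs i)).
  rewrite (bigD1_seq j ji (nbrs_uniq i)) /= ler_wpDr ?sumr_ge0 // => [k _|].
    exact: gift_ge0.
  by rewrite le_min lexx le_max big orbT.
rewrite -(vertex_excess_sum iln) big_seq [leRHS]big_seq; apply: ler_sum => j /lt1.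
by rewrite -ltNge => h; rewrite le_min le_max lexx orbT (ltW h).
Qed.

Lemma no_5_regular_drawing : False.
Proof.
have [lab [lab_psi chg]] := dart_labelling.
have cnt (P : pred (nat * nat)) c :
    count P (same_label lab c) = count (fun d => (lab d == c) && P d) darts.
  by rewrite count_filter; apply: eq_count => d /=; rewrite andbC.
pose M := (\max_(d <- darts) lab d).+1.
have labM d : d \in darts -> (lab d < M)%N by move=> dd; rewrite ltnS;
  apply: leq_bigmax_seq.
have : \sum_(d <- darts) gift d < \sum_(d <- darts) excess d.
  (* Class 0, of turning number at most -1, is split off: it makes the inequality strict. *)
  rewrite !(sum_classes _ labM) !big_ord_recl /= ltr_leD //.
    by apply: gift_sum_lt_excess => //; rewrite !cnt chg.
  by apply: ler_sum => c _; apply: gift_sum_le_excess => //; rewrite !cnt chg.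
apply/negP; rewrite -leNgt !sum_darts.
apply: ler_sum_nat => i /andP[_]; rewrite ltnS => iln.
by rewrite vertex_excess_sum // vertex_gift_sum.
Qed.

End Discharging.

Lemma size_nbrs (R : realType) n (x y : nat -> R) e i : drawing n x y e ->
  size (nbrs n x y e i) = count (e i) (iota 0 n.+1).
Proof.
move=> D; rewrite -size_filter; apply/perm_size/uniq_perm.
- exact: nbrs_uniq.
- by rewrite filter_uniq ?iota_uniq.
move=> j; rewrite (mem_nbrs D) mem_filter mem_iota; case h : (e i j) => //=.
by rewrite add0n ltnS (e_le D (j := i)) // (e_sym D).
Qed.

(** * From planar maps to drawings *)

Section Segments.
Variable R : realType.
Local Open Scope classical_set_scope.
Local Open Scope ring_scope.
Implicit Types a b c d p q : plane R.

Lemma segment_left a b : segment a b a.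
Proof.
exists 0; first by rewrite /= lexx ler01.
by case: a => a1 a2; rewrite /seg_point /= subr0 !mul1r !mul0r !addr0.
Qed.

Lemma segmentC a b : segment a b = segment b a.
Proof.
suff sub c d : segment c d `<=` segment d c by apply/seteqP; split; exact: sub.
move=> _ [t /= /andP[t0 t1] <-]; exists (1 - t); first by apply/andP; split; lra.
by rewrite /seg_point; congr pair; ring.
Qed.

Lemma segment_right a b : segment a b b.
Proof. by rewrite segmentC; exact: segment_left. Qed.

Lemma segment_inj a b c : segment a b = segment a c -> b = c.
Proof.
move=> eqs; have := segment_right a c; rewrite -eqs => -[t /= /andP[t0 t1] tE].
have := segment_right a b; rewrite eqs => -[u /= /andP[u0 u1] uE].
case: a b c tE uE {eqs} => [a1 a2] [b1 b2] [c1 c2];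
  rewrite /seg_point /= => -[<- <-] [h1 h2].
have [->|tN1] := eqVneq t 1; first by congr pair; ring.
have ut : 1 - u * t != 0 by apply/eqP => h; case/eqP: tN1; nra.
have ab (a b : R) : (1 - u) * a + u * ((1 - t) * a + t * b) = b -> b = a.
  move=> h; apply/eqP; rewrite -subr_eq0 -(mulIr_eq0 _ (mulIf ut)); apply/eqP.
  by move: h => /eqP; rewrite -subr_eq0 => /eqP h; rewrite -[RHS]oppr0 -h; ring.
by rewrite (ab _ _ h1) (ab _ _ h2); congr pair; ring.
Qed.

(** If [a] and [b] have parameters [u] and [v] on [segment p q], the point has parameter
    [(1 - t) u + t v]. At [p] this is 0, which forces [u = v = 0] and [a = b]. *)
Lemma seg_point_not_end a b p q t : a <> b -> 0 < t < 1 -> p <> q ->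
  segment a b = segment p q -> seg_point a b t <> p.
Proof.
move=> ab /andP[t0 t1] pq eqs pE.
have := segment_left a b; rewrite eqs => -[u /= /andP[u0 u1] uE].
have := segment_right a b; rewrite eqs => -[v /= /andP[v0 v1] vE].
have w0 : (1 - t) * u + t * v = 0.
  apply: contra_notP pq => /eqP w0.
  have eqc (c d : R) : (1 - t) * ((1 - u) * c + u * d) + t * ((1 - v) * c + v * d) = c -> c = d.
    move=> h; apply/eqP; rewrite -subr_eq0 -(mulIr_eq0 _ (mulIf w0)); apply/eqP.
    by move: h => /eqP; rewrite -subr_eq0 => /eqP h; rewrite -[RHS]oppr0 -h; ring.
  move: pE; rewrite -uE -vE /seg_point /=.
  by case: p q {uE vE eqs} => p1 p2 [q1 q2] /= [/eqc -> /eqc ->].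
have tu : 0 <= (1 - t) * u by apply: mulr_ge0 => //; lra.
have tv : 0 <= t * v by apply: mulr_ge0 => //; lra.
have u00 : u = 0 by apply: (mulfI (x := 1 - t)); [apply/eqP; lra | rewrite mulr0; lra].
have v00 : v = 0 by apply: (mulfI (x := t)); [apply/eqP; lra | rewrite mulr0; lra].
by apply: ab; rewrite -uE -vE u00 v00.
Qed.

(* Coordinates after a similarity of ratio sqrt (1 + t^2); for generic t no two
   vertices have the same abscissa. *)
Definition skew_x (t : R) p : R := p.1 + t * p.2.
Definition skew_y (t : R) p : R := p.2 - t * p.1.

Lemma generic_skew (s : seq (plane R)) : exists t, {in s &, injective (skew_x t)}.
Proof.
pose F (p q : plane R) : R := `|(p.1 - q.1) / (p.2 - q.2)|.
(* This [t] exceeds every [F p q], while two points of different ordinate and equal skew abscissa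
   would have coordinate differences with quotient [-t]. *)
exists (1 + \sum_(p <- s) \sum_(q <- s) F p q) => p q ps qs; rewrite /skew_x.
have term (T : eqType) (G : T -> R) (r : seq T) z :
    (forall z, 0 <= G z) -> z \in r -> G z <= \sum_(z <- r) G z.
  by move=> G0 zr; rewrite (big_rem z zr) /= ler_wpDr // sumr_ge0.
have le : F p q <= \sum_(p <- s) \sum_(q <- s) F p q.
  apply: le_trans (term _ (fun p => \sum_(q <- s) F p q) s p _ ps).
    by apply: term => // ?; apply: normr_ge0.
  by move=> ?; apply: sumr_ge0 => ? _; apply: normr_ge0.
move: (\sum_(p <- s) _) le => S le h.
have [eq2|neq2] := eqVneq p.2 q.2.
  have : p.1 = q.1 by move: h; rewrite eq2 => /addIr.
  by case: p q eq2 {ps qs le h} => ? ? [? ?] /= -> ->.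
have d0 : p.2 - q.2 != 0 by rewrite subr_eq0.
have : (p.1 - q.1) / (p.2 - q.2) = - (1 + S).
  by apply: (mulIf d0); rewrite mulfVK //; move: h; lra.
move=> eS; move: le; rewrite /F eS normrN => le.
by have := le_trans (ler_norm (1 + S)) le; rewrite gerDr ler10.
Qed.

Lemma skew_inj t p q : skew_x t p = skew_x t q -> skew_y t p = skew_y t q -> p = q.
Proof.
case: p q => p1 p2 [q1 q2]; rewrite /skew_x /skew_y /= => h1 h2.
have t0 : 1 + t ^+ 2 != 0 by apply: lt0r_neq0; rewrite ltr_pwDl // sqr_ge0.
congr pair; apply: (mulfI t0).
  transitivity ((p1 + t * p2) - t * (p2 - t * p1)); first by ring.
  by rewrite h1 h2; ring.
transitivity ((p2 - t * p1) + t * (p1 + t * p2)); first by ring.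
by rewrite h1 h2; ring.
Qed.

(** Leads from [height] in skew coordinates back to a point of the original segment. *)
Lemma skew_point t a b z : skew_x t a < z < skew_x t b ->
  exists u, [/\ 0 < u < 1, skew_x t (seg_point a b u) = z &
    skew_y t (seg_point a b u) = skew_y t a +
      (skew_y t b - skew_y t a) / (skew_x t b - skew_x t a) * (z - skew_x t a)].
Proof.
move=> /andP[az zb]; have d0 : 0 < skew_x t b - skew_x t a by lra.
have dN0 := lt0r_neq0 d0.
exists ((z - skew_x t a) / (skew_x t b - skew_x t a)); split.
- by apply/andP; split; [apply: divr_gt0;
    rewrite // subr_gt0 | rewrite ltr_pdivrMr // mul1r ltrD2r].
- transitivity (skew_x t a + (z - skew_x t a) / (skew_x t b - skew_x t a) *
    (skew_x t b - skew_x t a)); last by rewrite mulfVK // addrC subrK.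
  by move: (_ / _) => u; rewrite /skew_x /seg_point /=; ring.
rewrite mulrAC -mulrA; move: (_ / _) => u.
by rewrite /skew_y /seg_point /=; ring.
Qed.

Lemma skew_norm t a b : (skew_x t b - skew_x t a) ^+ 2 + (skew_y t b - skew_y t a) ^+ 2 =
  (1 + t ^+ 2) * edist a b ^+ 2.
Proof.
by rewrite /edist sqr_sqrtr ?addr_ge0 ?sqr_ge0 // /skew_x /skew_y; ring.
Qed.

End Segments.

(** * Adjacency and incidence in a planar map *)

Section Reduction.
Variables (R : realType) (V : set (plane R)) (E : set (set (plane R))).
Local Open Scope classical_set_scope.
Local Open Scope ring_scope.
Hypothesis planar : straight_planar_map V E.
Implicit Types a b c d p q : plane R.

Definition adjacent a b : Prop := a <> b /\ E (segment a b).

Lemma vertex_off_edge p a b t : V p -> adjacent a b -> 0 < t < 1 ->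
  seg_point a b t <> p.
Proof.
move=> Vp [ab Es] t01 pE; case: planar => _ _ _ /(_ p _ Vp Es); apply.
by exists a, b; split=> //; exists t.
Qed.

Lemma vertex_on_edge p a b : V p -> adjacent a b -> segment a b p -> p = a \/ p = b.
Proof.
move=> Vp adj [t /= /andP[t0 t1] tE]; have := @vertex_off_edge p a b t Vp adj.
move: t0 t1; rewrite le_eqVlt => /orP[/eqP t0 _ _|t0].
  by left; rewrite -tE -t0 /seg_point; case: (a) => a1 a2 /=; congr pair; ring.
rewrite le_eqVlt => /orP[/eqP t1 _|t1]; last by rewrite t0 t1 => /(_ isT).
by right; rewrite -tE t1 /seg_point; case: (b) => b1 b2 /=; congr pair; ring.
Qed.

(** Distinct edges meet only in endpoints, and an inner point is none; so the segments coincide and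
    their ends, being vertices, match. *)
Lemma edges_meet a b c d t u : V c -> V d -> adjacent a b -> adjacent c d ->
  0 < t < 1 -> 0 < u < 1 -> seg_point a b t = seg_point c d u ->
  (a = c /\ b = d) \/ (a = d /\ b = c).
Proof.
move=> Vc Vd adj1 adj2 t01 u01 eqp; move: (adj1) (adj2) => [ab E1] [cd E2].
have [eqs|neqs] := pselect (segment a b = segment c d).
  have := vertex_on_edge Vc adj1; rewrite eqs => /(_ (segment_left c d)).
  have := vertex_on_edge Vd adj1; rewrite eqs => /(_ (segment_right c d)).
  by move=> [] dE [] cE; [case: cd; rewrite cE dE|right|left|case: cd; rewrite cE dE].
case: planar => _ _ /(_ _ _ E1 E2 neqs) [_ /(_ (seg_point a b t))] + _.
case.
  split; first by exists t => //=; case/andP: t01 => *; rewrite !ltW.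
  by rewrite eqp; exists u => //=; case/andP: u01 => *; rewrite !ltW.
move=> [q [pq eqs]] _.
by case: (seg_point_not_end ab t01 pq eqs).
Qed.

(** The other end that [endpoint] provides is not known to be a vertex. The ends that planarity
    provides are vertices, and [p], lying on the edge, is one of them. *)
Lemma endpoint_adjacent p s : V p -> E s -> endpoint p s ->
  exists q, [/\ V q, adjacent p q & s = segment p q].
Proof.
move=> Vp Es [q [pq sE]].
have [a [b [Va Vb [ab sE']]]] : exists a b, [/\ V a, V b & joins s a b].
  by case: planar => _ /(_ _ Es).
have adj : adjacent a b by split; rewrite -?sE'.
have : segment a b p by rewrite -sE' sE; exact: segment_left.
move=> /(vertex_on_edge Vp adj) [] pE.
  by exists b; rewrite pE; split=> //.
exists a; rewrite pE; split=> //; last by rewrite segmentC.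
by split; [move=> /esym | rewrite segmentC -sE'].
Qed.

(** Mapping a neighbour [q] in [N] to [segment p q] is a bijection onto the edges at [p]. *)
Lemma degree_count p (s : seq (plane R)) k : V = [set` s] -> uniq s -> V p ->
  ([set t | E t /\ endpoint p t] #= `I_k)%card ->
  count (fun q => `[< adjacent p q >]) s = k.
Proof.
move=> VE us Vp; rewrite -size_filter; set N := seq.filter _ s.
have uN : uniq N by rewrite filter_uniq.
have -> : [set t | E t /\ endpoint p t] = (fun i => segment p (nth p N i)) @` `I_(size N).
  apply/seteqP; split=> [t [Et /(endpoint_adjacent Vp Et)[q [Vq adj tE]]]|_ [i iN <-]].
    have qN : q \in N.
      by rewrite mem_filter; apply/andP; split; [exact/asboolP | move: Vq; rewrite VE].
    by exists (index q N); rewrite /= ?index_mem // nth_index.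
  have := mem_nth p iN; rewrite mem_filter => /andP[/asboolP [pq Es] _].
  by split=> //; exists (nth p N i).
move=> cE; apply/card_eq_II; apply: card_eq_trans cE.
rewrite card_eq_sym; apply: inj_card_eq => i j; rewrite !inE /= => iN jN /segment_inj.
by move/eqP; rewrite nth_uniq // => /eqP.
Qed.

Section SortedVertices.
Variables (t : R) (s : seq (plane R)) (z0 : plane R).
Hypothesis VE : V = [set` s].
Hypothesis s_sorted : sorted (fun p q => skew_x t p < skew_x t q) s.
Hypothesis s_size : (0 < size s)%N.

Let pt i := nth z0 s i.
Let x i := skew_x t (pt i).
Let y i := skew_y t (pt i).

Definition adj_index i j :=
  [&& (i < size s)%N, (j < size s)%N & `[< adjacent (pt i) (pt j) >]].

Lemma pt_vertex i : (i < size s)%N -> V (pt i).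
Proof. by move=> h; rewrite VE /=; apply: mem_nth. Qed.

Lemma x_increasing i j : (i < j)%N -> (j < size s)%N -> x i < x j.
Proof.
move=> ij js; apply: (sorted_ltn_nth (@ltkey_trans _ _ (skew_x t)) z0 s_sorted);
  by rewrite ?inE // (ltn_trans ij).
Qed.

Lemma right_edgeE (p : nat * nat) : right_edge adj_index p ->
  [/\ (p.1 < p.2 < size s)%N, V (pt p.1), V (pt p.2) & adjacent (pt p.1) (pt p.2)].
Proof. by move=> /andP[/and3P[h1 h2 /asboolP adj] ->]; split=> //; apply: pt_vertex. Qed.

(** By [skew_inj], a crossing or incidence in skew coordinates occurs among the original points,
    where [edges_meet] and [vertex_off_edge] exclude it. *)
Lemma sorted_drawing : drawing (size s).-1 x y adj_index.
Proof.
have le_size i : (i <= (size s).-1)%N = (i < size s)%N by rewrite -ltnS prednK.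
split.
- move=> i j; rewrite /adj_index andbCA; do 2!congr (_ && _).
  by apply/asboolP/asboolP => -[neq Es]; split; rewrite 1?segmentC // => /esym.
- by move=> i; apply/negP => /and3P[_ _ /asboolP [/(_ erefl)]].
- by move=> i j /and3P[h _ _]; rewrite le_size.
- by move=> i j /andP[ij]; rewrite le_size; apply: x_increasing.
- move=> p q z /right_edgeE[/andP[lp sp] Vp1 Vp2 adjp] /right_edgeE[/andP[lq sq] Vq1 Vq2 adjq].
  move=> pq op oq; apply/eqP => hE.
  have [u [u01 ux uy]] := skew_point op; have [v [v01 vx vy]] := skew_point oq.
  have eqp : seg_point (pt p.1) (pt p.2) u = seg_point (pt q.1) (pt q.2) v.
    by apply: (@skew_inj R t); [rewrite ux vx | rewrite uy vy; exact: hE].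
  have us : uniq s.
    by apply: (map_uniq (f := skew_x t)); apply: lt_sorted_uniq; rewrite sorted_map.
  have inj i j : (i < size s)%N -> (j < size s)%N -> pt i = pt j -> i = j.
    by move=> si sj /eqP; rewrite nth_uniq // => /eqP.
  have [lp' lq'] := (ltn_trans lp sp, ltn_trans lq sq).
  case: (edges_meet Vq1 Vq2 adjp adjq u01 v01 eqp) => -[/inj e1 /inj e2].
    by case/eqP: pq; move: (e1 lp' lq') (e2 sp sq); case: (p) (q) => ? ? [? ?] /= -> ->.
  by move: lp lq; rewrite (e1 lp' sq) (e2 sp lq'); case: ltngtP.
move=> p k /right_edgeE[/andP[lp sp] Vp1 Vp2 adjp] /andP[pk kp]; apply/eqP => hE.
have sk : (k < size s)%N := ltn_trans kp sp.
have [u [u01 ux uy]] : exists u, [/\ 0 < u < 1,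
    skew_x t (seg_point (pt p.1) (pt p.2) u) = x k &
    skew_y t (seg_point (pt p.1) (pt p.2) u) = y k].
  rewrite -hE; apply: skew_point; apply/andP; split; apply: x_increasing => //.
by apply: (vertex_off_edge (pt_vertex sk) adjp u01); apply: (@skew_inj R t).
Qed.

End SortedVertices.
End Reduction.

(** * Contradiction for a map regular of degree 5 *)

Local Open Scope classical_set_scope.

Theorem mainTheorem1 (R : realType) :
  ~ exists (V : set (plane R)) (E : set (set (plane R))),
      [/\ V !=set0,
          straight_planar_map V E,
          equal_edges E
        & regular_of_degree 5 V E].
Proof.
move=> [V [E [[z0 Vz0] planar [l lE] reg]]].
have [s0 VE0] : exists s0 : seq (plane R), V = [set` s0].
  by apply/finite_seqP; case: planar.
have [t tinj] := generic_skew s0.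
pose s := ksort (skew_x t) (undup s0).
have VE : V = [set` s] by rewrite VE0; apply/seteqP; split=> p /=;
  rewrite mem_sort mem_undup.
have us : uniq s by rewrite sort_uniq undup_uniq.
have s_sorted : sorted (fun p q => skew_x t p < skew_x t q)%R s.
  apply: ksort_lt; rewrite map_inj_in_uniq ?undup_uniq // => p q.
  by rewrite !mem_undup; apply: tinj.
have s_size : (0 < size s)%N by move: Vz0; rewrite VE /=; case: (s).
have D := sorted_drawing planar z0 VE s_sorted s_size.
have deg i : (i <= (size s).-1)%N -> count (adj_index E s z0 i) (iota 0 (size s).-1.+1) = 5.
  rewrite -ltnS prednK // => si.
  have Vi : V (nth z0 s i) by rewrite VE /=; apply: mem_nth.
  rewrite -(degree_count planar VE us Vi (reg _ Vi)) -[in RHS](mkseq_nth z0 s) count_map.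
  by apply: eq_in_count => j; rewrite mem_iota /= add0n /adj_index si mkseq_nth => ->.
(* Vertex 0 has degree 5, so an edge exists; its ends are distinct, which makes the common length
   nonzero. *)
have [j adj] : exists j, adj_index E s z0 0 j.
  have : has (adj_index E s z0 0) (iota 0 (size s).-1.+1) by rewrite has_count deg.
  by case/hasP => j _ adj; exists j.
have len i k : adj_index E s z0 i k -> edist (nth z0 s i) (nth z0 s k) = l.
  by move=> /and3P[_ _ /asboolP [neq Es]]; apply: (lE _ _ _ Es).
have l2 : (l ^+ 2 != 0)%R.
  rewrite -(len _ _ adj) /edist sqr_sqrtr ?addr_ge0 ?sqr_ge0 //.
  rewrite paddr_eq0 ?sqr_ge0 // !sqrf_eq0 !subr_eq0 -xpair_eqE -!surjective_pairing.
  by case/and3P: adj => _ _ /asboolP [neq _]; apply/eqP.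
have lp : (0 < (1 + t ^+ 2) * l ^+ 2)%R.
  by rewrite mulr_gt0 ?ltr_pwDl ?sqr_ge0 // lt_neqAle eq_sym l2 sqr_ge0.
(* The skew multiplies all lengths by the square root of [1 + t^2]. *)
apply: (@no_5_regular_drawing R _ _ _ _ (Num.sqrt ((1 + t ^+ 2) * l ^+ 2)) D).
- by rewrite sqrtr_gt0.
- by move=> i k adj'; rewrite sqr_sqrtr ?ltW // skew_norm (len _ _ adj').
- by move=> i si; rewrite (size_nbrs _ D) deg.
Qed.
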